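(* Let $0 < \mathfrak{p} < \frac{\pi}{2}$. Then the set $X_{\mathfrak{p}} = \{ v \in H^1_{\rm loc}(\mathbb{R},\mathbb{C}) : E(v) < \frac{2\sqrt{2}}{3} \text{ and } p(v) = \mathfrak{p} \}$ is not empty, and $$E(\mathfrak{v}_{c(\mathfrak{p})}) = \inf \{ E(v) : v \in X_{\mathfrak{p}} \},$$ that is, the infimum $E_{\min}(\mathfrak{p}) = \inf\{E(v) : v \in X_{\mathfrak p}\}$ is achieved, and the only minimizer, up to the invariances (translations $v \mapsto v(\cdot - a)$, $a \in \mathbb{R}$, and multiplications by constants of modulus one, $v \mapsto e^{i\theta} v$, $\theta \in \mathbb{R}$), is $\mathfrak{v}_{c(\mathfrak{p})}$.
   Context: For $v \in H^1_{\rm loc}(\mathbb{R},\mathbb{C})$, the Ginzburg-Landau energy is $E(v) = \int_{\mathbb{R}} e(v) \in [0,+\infty]$ with $e(v) = \frac12 |v'|^2 + \frac14 (1-|v|^2)^2$. Any $v \in H^1_{\rm loc}(\mathbb{R},\mathbb{C})$ with $E(v) < \frac{2\sqrt2}{3}$ satisfies $\inf_{\mathbb{R}} |v| > 0$, so it can be written $v = \varrho \exp(i\varphi)$ with $\varrho = |v|$ and $\varphi$ a continuous real-valued phase, $\varphi \in H^1_{\rm loc}(\mathbb{R})$. For such $v$ the renormalized momentum is $p(v) = \frac12 \int_{\mathbb{R}} (1-\varrho^2)\varphi'$ (a convergent integral). For $0 \leq c < \sqrt2$, $\mathfrak{v}_c(x) = \sqrt{\frac{2-c^2}{2}} \tanh\Big(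 \frac{\sqrt{2-c^2}}{2} x \Big) - i \frac{c}{\sqrt2}$; it solves $i c v' + v'' + v(1-|v|^2) = 0$ on $\mathbb{R}$. For $0 < \mathfrak{p} < \frac{\pi}{2}$, $c(\mathfrak{p})$ denotes the unique $c \in (0,\sqrt2)$ such that $\mathfrak{p} = \frac{\pi}{2} - \arctan\Big(\frac{c}{\sqrt{2-c^2}}\Big) - \frac{c}{2}\sqrt{2-c^2}$. *)

(* Defs.v *)
From HB Require Import structures.
From mathcomp Require Import all_boot all_order all_algebra.
From mathcomp Require Import complex.
From mathcomp Require Import all_classical all_reals all_analysis.

Set Implicit Arguments.
Unset Strict Implicit.
Unset Printing Implicit Defensive.

Import Order.TTheory GRing.Theory Num.Theory.
Import numFieldNormedType.Exports.

Local Open Scope classical_set_scope.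
Local Open Scope complex_scope.
Local Open Scope ring_scope.

Definition L2loc (R : realType) (w : R -> R) : Prop :=
  measurable_fun setT w /\ locally_integrable setT (fun x => w x ^+ 2).

(* Class C^1 test functions give the same weak derivatives as smooth ones. *)
Definition test_function (R : realType) (phi : R -> R) : Prop :=
  [/\ forall x, derivable phi x 1,
      continuous (phi^`())%classic &
      exists2 K : set R, compact K & forall x, ~ K x -> phi x = 0].

Definition is_L2loc_weak_derivative (R : realType) (u w : R -> R) : Prop :=
  L2loc w /\
  forall phi, test_function phi ->
    \int[lebesgue_measure]_(x in setT) (u x * (phi^`())%classic x) =
    - \int[lebesgue_measure]_(x in setT) (w x * phi x).

(* The weak derivative is unique only up to a null set; it is used below only
   under integral signs, so the choice of representative is irrelevant. *)
Definition weak_derivative (R : realType) (u : R -> R) : R -> R :=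
  xget (fun=> 0) [set w | is_L2loc_weak_derivative u w].

(* Elements of H^1_loc(R) are classes modulo null sets; every class has exactly
   one continuous representative, and the class is identified with it. *)
Definition H1loc (R : realType) (u : R -> R) : Prop :=
  [/\ continuous u, L2loc u & exists w, is_L2loc_weak_derivative u w].

Definition H1locC (R : realType) (v : R -> R[i]) : Prop :=
  H1loc (fun x => complex.Re (v x)) /\ H1loc (fun x => complex.Im (v x)).

Definition weak_derivativeC (R : realType) (v : R -> R[i]) : R -> R[i] :=
  fun x => weak_derivative (fun y => complex.Re (v y)) x
       +i* weak_derivative (fun y => complex.Im (v y)) x.

(* [normc] is the real-valued modulus; the norm `|z| has values in R[i]. *)
Definition modulus (R : realType) (z : R[i]) : R := Normc.normc z.

Definition energy_density (R : realType) (v : R -> R[i]) (x : R) : R :=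
  2^-1 * modulus (weak_derivativeC v x) ^+ 2
  + 4^-1 * (1 - modulus (v x) ^+ 2) ^+ 2.

Definition energy (R : realType) (v : R -> R[i]) : \bar R :=
  (\int[lebesgue_measure]_(x in setT) (energy_density v x)%:E)%E.

Definition expi (R : realType) (t : R) : R[i] := cos t +i* sin t.

Definition is_phase (R : realType) (v : R -> R[i]) (phi : R -> R) : Prop :=
  H1loc phi /\ forall x, v x = (modulus (v x))%:C * expi (phi x).

(* If v does not vanish, two phases differ by a constant, so the momentum does
   not depend on the chosen one.  It is meaningful only for v in H^1_loc with
   E(v) < 2 sqrt(2) / 3, which is the only case in which it is used. *)
Definition phase (R : realType) (v : R -> R[i]) : R -> R :=
  xget (fun=> 0) [set phi | is_phase v phi].

Definition momentum (R : realType) (v : R -> R[i]) : R :=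
  2^-1 * \int[lebesgue_measure]_(x in setT)
           ((1 - modulus (v x) ^+ 2) * weak_derivative (phase v) x).

Definition tanh (R : realType) (x : R) : R :=
  (expR x - expR (- x)) / (expR x + expR (- x)).

Definition travelling_wave (R : realType) (c : R) : R -> R[i] :=
  fun x => (Num.sqrt ((2 - c ^+ 2) / 2)
              * tanh (Num.sqrt (2 - c ^+ 2) / 2 * x))%:C
           - 'i * (c / Num.sqrt 2)%:C.

(* For 0 < p < pi / 2 the set below is a singleton. *)
Definition speed (R : realType) (p : R) : R :=
  xget 0 [set c | [/\ 0 < c, c < Num.sqrt 2 &
    p = pi / 2 - atan (c / Num.sqrt (2 - c ^+ 2))
        - c / 2 * Num.sqrt (2 - c ^+ 2)]].

Definition admissible (R : realType) (p : R) : set (R -> R[i]) :=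
  [set v | [/\ H1locC v, (energy v < (2 * Num.sqrt 2 / 3)%:E)%E &
               momentum v = p]].

Definition E_min (R : realType) (p : R) : \bar R :=
  ereal_inf [set energy v | v in admissible p].

(* Main.v *)
(* Write v = rho exp(i phi) and eta = 1 - rho^2.  If rho has minimum m = cos be,
   completing squares with c = sqrt 2 * m gives, for every point a and the sign
   side a of x - a,

     e(v) = (c / 2) eta phi' + side a * slope m rho * rho'
            + (rho' - side a * slope m rho)^2 / 2
            + (rho phi' - c eta / (2 rho))^2 / 2.

   The second term is the derivative of a function of rho on each side of a;
   taking for a a minimum point of rho and integrating, E(v) >= c p(v) + K(be),
   where the right-hand side is the value at p(v) of the tangent line, at the
   momentum of the wave of speed c, to the curve (p(v_c), E(v_c)).  That curve is
   strictly concave, so the tangent lines lie above it, and E(v) >= E(v_c(p)).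

   In the equality case be is the angle of c(p) and both squares vanish.  The
   equation for rho has non-unique solutions at the minimum point, but all of them
   lie below the profile of the wave, and phi' and the momentum density are
   decreasing functions of rho; since the momenta agree, so do the profiles.

   Since momentum v <> 0, a phase exists, and rho = Re (exp(-i phi) v) is weakly
   differentiable without any discussion of the zeros of v. *)

Require Import Defs.
From HB Require Import structures.
From mathcomp Require Import all_boot all_order all_algebra.
From mathcomp Require Import complex.
From mathcomp Require Import all_classical all_reals all_analysis.
From mathcomp Require Import measurable_realfun ring lra.

Set Implicit Arguments.
Unset Strict Implicit.
Unset Printing Implicit Defensive.

Import Order.TTheory GRing.Theory Num.Theory.
Import numFieldNormedType.Exports.

Local Open Scope classical_set_scope.
Local Open Scope complex_scope.
Local Open Scope ring_scope.

(** Why the minimum m of the modulus fixes the speed: [slope m] contains [sqrt (rho ^ 2 - m ^ 2)],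
    real along the whole map because m is a lower bound, and its primitive taken from m vanishes at
    the minimum point, so the sign [side a] may jump there. Each map is thus compared with a tangent
    line of its own. A modulus that is nowhere below 1 is compared with the limiting line of speed
    [sqrt 2]. Writing c = [sqrt 2 * cos al] turns the momentum of the wave into
    [al - sin al * cos al] and its energy into [2 * sqrt 2 / 3 * sin al ^ 3], so comparing tangent
    lines amounts to the sign of one derivative in the angle. The bound [2 * sqrt 2 / 3] is twice
    the least cost of joining modulus 0 to modulus 1. Below it the modulus stays away from 0, which
    makes the momentum density integrable; finiteness of the energy makes the modulus tend to 1 at
    both ends, which gives the boundary values of the primitives. Maps are only H^1_loc, so the
    calculus is done with pairs (function, density) instead of pointwise derivatives; product and
    chain rules come from comparing increments with those of a monotone function. *)

Section continuity.
Context {R : realType}.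
Implicit Types f g : R -> R.

Lemma continuous_constant (c : R) : continuous (fun _ : R => c).
Proof. exact: cst_continuous. Qed.

Lemma continuous_identity : continuous (fun x : R => x).
Proof. by move=> x; exact: cvg_id. Qed.

Lemma continuous_add f g : continuous f -> continuous g ->
  continuous (fun x => f x + g x).
Proof. by move=> cf cg x; apply: continuousD; [exact: cf|exact: cg]. Qed.

Lemma continuous_opp f : continuous f -> continuous (fun x => - f x).
Proof. by move=> cf x; apply: continuousN; exact: cf. Qed.

Lemma continuous_mul f g : continuous f -> continuous g ->
  continuous (fun x => f x * g x).
Proof. by move=> cf cg x; apply: continuousM; [exact: cf|exact: cg]. Qed.

Lemma continuous_pow f n : continuous f -> continuous (fun x => f x ^+ n).
Proof.
move=> cf; elim: n => [|n IH]; first exact: continuous_constant.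
by under [X in continuous X]eq_fun do rewrite exprS; exact: continuous_mul.
Qed.

Lemma continuous_inv f : continuous f -> (forall x, f x != 0) ->
  continuous (fun x => (f x)^-1).
Proof. by move=> cf f0 x; apply: continuousV; [exact: f0|exact: cf]. Qed.

Lemma continuous_compose f g : continuous f -> continuous g ->
  continuous (fun x => g (f x)).
Proof. by move=> cf cg x; apply: continuous_comp; [exact: cf|exact: cg]. Qed.

End continuity.

(* Syntactic matching, because unification would unfold definitions to find
   sums and products. *)
Ltac continuity :=
  match goal with
  | H : continuous ?f |- continuous ?f => exact: H
  | |- continuous (fun x => @?f x + @?g x) =>
      apply: (@continuous_add _ f g); continuity
  | |- continuous (fun x => - @?f x) => apply: (@continuous_opp _ f); continuity
  | |- continuous (fun x => @?f x * @?g x) =>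
      apply: (@continuous_mul _ f g); continuity
  | |- continuous (fun x => @?f x ^+ ?n) =>
      apply: (@continuous_pow _ f n); continuity
  | |- continuous (fun x => x) => exact: continuous_identity
  | |- continuous (fun x => ?c) => exact: continuous_constant
  | |- _ => idtac
  end.

(** * Primitives of locally integrable functions *)

Section density.
Context {R : realType}.
Notation mu := (@lebesgue_measure R).
Implicit Types u v w k h : R -> R.

(** Local absolute continuity with derivative [w] almost everywhere, in integral form: no pointwise
    differentiability is asked, and [w] may be changed on a null set. *)
Definition has_density u w : Prop :=
  [/\ measurable_fun setT w,
      forall a b : R, mu.-integrable `[a, b] (EFin \o w) &
      forall a b : R, a <= b -> u b - u a = \int[mu]_(x in `[a, b]) w x].

Lemma ae_imply (P Q : R -> Prop) : (forall x, P x -> Q x) ->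
  {ae mu, forall x, P x} -> {ae mu, forall x, Q x}.
Proof. exact: (@filterS _ _ (ae_filter_ringOfSetsType mu)). Qed.

Lemma integrable_EFinZ (D : set R) c w : measurable D ->
  mu.-integrable D (EFin \o w) -> mu.-integrable D (EFin \o (fun x => c * w x)).
Proof. by move=> mD iw; exact: (@integrableZl _ _ _ mu D mD c (EFin \o w) iw). Qed.

Lemma integrable_EFinD (D : set R) w z : measurable D ->
  mu.-integrable D (EFin \o w) -> mu.-integrable D (EFin \o z) ->
  mu.-integrable D (EFin \o (fun x => w x + z x)).
Proof. by move=> mD iw iz; exact: (@integrableD _ _ _ mu D mD (EFin \o w) (EFin \o z)
  iw iz). Qed.

Lemma integrable_EFinB (D : set R) w z : measurable D ->
  mu.-integrable D (EFin \o w) -> mu.-integrable D (EFin \o z) ->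
  mu.-integrable D (EFin \o (fun x => w x - z x)).
Proof. by move=> mD iw iz; exact: (@integrableB _ _ _ mu D mD (EFin \o w) (EFin \o z)
  iw iz). Qed.

(** Let s be the supremum of the points of [[a, b]] where [h] is at least [h a]. The left half of
    the local hypothesis at s shows that s is such a point; the right half would push beyond s if s
    were less than b. *)
Lemma locally_nondecreasing_le h :
  (forall t, \forall y \near t, (y <= t -> h y <= h t) /\ (t <= y -> h t <= h y)) ->
  forall a b, a <= b -> h a <= h b.
Proof.
move=> hloc a b ab.
pose S := [set y | a <= y <= b /\ h a <= h y].
have Sa : S a by rewrite /S /= lexx ab; split.
have Sb : has_ubound S by exists b => y [/andP[]].
have hS : has_sup S by split; [exists a|].
set s := sup S.
have as_ : a <= s by apply: ub_le_sup.
have sb : s <= b by apply: ge_sup; [exists a|move=> y [/andP[]]].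
have /nbhs_ballP[d /= d0 hd] := hloc s.
have hs : h a <= h s.
  have [y [/andP[ay yb] hy]] := sup_adherent d0 hS; rewrite -/s => sdy.
  have ys : y <= s by apply: ub_le_sup => //; split => //; rewrite ay yb.
  apply: (le_trans hy); apply (hd y) => //.
  by rewrite /ball /= ger0_norm ?subr_ge0// ltrBlDl -ltrBlDr.
have [sb'|bs] := ltP s b; last first.
  by have -> : b = s by apply/eqP; rewrite eq_le sb bs.
pose y := Num.min b (s + d / 2).
have sy : s < y by rewrite lt_min sb' ltrDl divr_gt0.
have : S y.
  split; first by rewrite (le_trans as_ (ltW sy)) ge_min lexx.
  apply: (le_trans hs); apply (hd y); last exact: ltW.
  rewrite /ball /= distrC ger0_norm ?subr_ge0 1?ltW// ltrBlDl.
  by rewrite gt_min ltrD2l [X in _ || X](_ : _ = true) ?orbT//; lra.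
by move/(ub_le_sup Sb); rewrite leNgt sy.
Qed.

(** The derivative of [h] with respect to [M] is zero at every point. Hence [e * M - h] and
    [e * M + h] are locally nondecreasing for each e > 0, so monotone, and e tends to 0. With [M] a
    primitive of some [|w|], this proves the product and chain rules without almost everywhere
    differentiation. *)
Lemma locally_negligible_variation_cst h M :
  (forall a b, a <= b -> M a <= M b) ->
  (forall t e, 0 < e -> \forall y \near t, `|h y - h t| <= e * `|M y - M t|) ->
  forall a b, h a = h b.
Proof.
move=> Mnd hM.
suff H s e (ns : `|s| = 1) : 0 < e -> forall a b, a <= b ->
  s * (h b - h a) <= e * (M b - M a).
  have K a b : a <= b -> h a = h b.
    move=> ab; apply/eqP; rewrite eq_sym -subr_eq0 -normr_le0.
    apply/ler_addgt0Pl => e e0; rewrite addr0.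
    (* The added 1 keeps the divisor positive when [M] is constant on [[a, b]]. *)
    have M0 : 0 < M b - M a + 1 by rewrite ltr_wpDl ?subr_ge0 ?Mnd.
    have e1 : 0 < e / (M b - M a + 1) by rewrite divr_gt0.
    have e2 : e / (M b - M a + 1) * (M b - M a) <= e.
      by rewrite mulrAC ler_pdivrMr// ler_pM2l// lerDl.
    rewrite ler_norml lerNl; apply/andP; split; apply: le_trans e2.
      by rewrite -mulN1r H// normrN1.
    by rewrite -[leLHS]mul1r H// normr1.
  by move=> a b; have [/K//|/ltW/K] := leP a b.
move=> e0 a b ab.
suff : e * M a - s * h a <= e * M b - s * h b by rewrite !mulrBr; lra.
apply: (@locally_nondecreasing_le (fun x => e * M x - s * h x)) => // t.
near=> y.
have ht : `|h y - h t| <= e * `|M y - M t| by near: y; exact: hM.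
have hs : `|s * (h y - h t)| <= e * `|M y - M t| by rewrite normrM ns mul1r.
move: hs; rewrite ler_norml !mulrBr => /andP[hs1 hs2]; split => yt.
  by move: hs1; rewrite ler0_norm ?subr_le0 ?Mnd//; lra.
by move: hs2; rewrite ger0_norm ?subr_ge0 ?Mnd//; lra.
Unshelve. all: by end_near. Qed.

Lemma eq_has_density u u' w w' :
  (forall x, u x = u' x) -> (forall x, w x = w' x) ->
  has_density u w -> has_density u' w'.
Proof. by move=> /funext -> /funext ->. Qed.

Lemma has_density_continuous u w : has_density u w -> continuous u.
Proof.
move=> [_ iw uw] x.
have xI : x \in `](x - 1), (x + 1)[ by rewrite in_itv/=; apply/andP; split; lra.
have le1 : x - 1 < x + 1 by lra.
have [+ _ _] := (continuous_within_itvP _ le1).1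
  (parameterized_integral_continuous (ltW le1) (iw _ _)).
move=> /(_ x xI) cx.
suff : {for x, continuous (fun y => u (x - 1) + parameterized_integral mu (x - 1) y w)}.
  rewrite /prop_for /continuous_at.
  rewrite {2}/parameterized_integral -uw; last by lra.
  rewrite subrKC; apply: cvg_trans; apply: near_eq_cvg; near=> y.
  rewrite /parameterized_integral -uw ?subrKC//.
  by apply: ltW; near: y; apply: lt_nbhsr; lra.
by apply: continuousD => //; exact: cvg_cst.
Unshelve. all: by end_near. Qed.

Lemma RintegralU_itv w (a b c : R) : a <= b -> b <= c ->
  mu.-integrable `[a, c] (EFin \o w) ->
  \int[mu]_(x in `[a, c]) w x =
  \int[mu]_(x in `[a, b]) w x + \int[mu]_(x in `[b, c]) w x.
Proof.
move=> ab bc iw.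
have := @Rintegral_itvB _ w (BLeft a) (BRight c) b iw; rewrite !bnd_simp.
move=> /(_ ab bc) /eqP; rewrite subr_eq addrC => /eqP ->.
congr (_ + _); apply: Rintegral_itv_obnd_cbnd.
by apply: integrableS iw => //; apply: subset_itvr; rewrite bnd_simp.
Qed.

Lemma density_exists w : measurable_fun setT w ->
  (forall a b : R, mu.-integrable `[a, b] (EFin \o w)) ->
  exists u, has_density u w.
Proof.
move=> mw iw.
exists (fun x => if 0 <= x then \int[mu]_(t in `[0, x]) w t
                 else - \int[mu]_(t in `[x, 0]) w t).
split => // a b ab; case: leP => b0; case: leP => a0.
- by rewrite (@RintegralU_itv w 0 a b)//; ring.
- by rewrite (@RintegralU_itv w a 0 b) ?(ltW a0)//; ring.
- by move: (lt_le_trans b0 (le_trans a0 ab)); rewrite ltxx.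
- by rewrite (@RintegralU_itv w a b 0) ?(ltW b0)//; ring.
Qed.

Lemma density_primitive_cst u v w : has_density u w -> has_density v w ->
  forall a b, u a - v a = u b - v b.
Proof.
move=> [_ _ uw] [_ _ vw] a b.
by have [ab|/ltW ab] := leP a b; have := uw _ _ ab; rewrite -vw//; lra.
Qed.

Lemma has_density_norm w m : has_density m (fun x => `|w x|) ->
  forall a b, a <= b -> m a <= m b.
Proof. by move=> [_ _ mw] a b ab; rewrite -subr_ge0 mw//; exact: Rintegral_ge0. Qed.

Lemma integrable_norm_itv w (a b : R) : measurable_fun setT w ->
  mu.-integrable `[a, b] (EFin \o w) ->
  mu.-integrable `[a, b] (EFin \o (fun x => `|w x|)).
Proof. by move=> mw iw; exact: integrable_norm. Qed.

Lemma integrable_continuousM k w (a b : R) : continuous k ->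
  measurable_fun setT w -> mu.-integrable `[a, b] (EFin \o w) ->
  mu.-integrable `[a, b] (EFin \o (fun x => k x * w x)).
Proof.
move=> ck mw iw; suff : mu.-integrable `[a, b] ((EFin \o k) \* (EFin \o w))%E by [].
apply: integrableMr => //.
- by apply: measurable_funTS; exact: continuous_measurable_fun.
- have : compact (k @` `[a, b]).
    by apply: continuous_compact; [exact: continuous_subspaceT|exact: segment_compact].
  move=> /compact_bounded[M [Mr HM]]; exists M; split => // x Mx y aby.
  by apply: (HM x Mx); exists y.
Qed.

Lemma le_density_norm u w m : has_density u w -> has_density m (fun x => `|w x|) ->
  forall a b, `|u b - u a| <= `|m b - m a|.
Proof.
move=> [mw iw uw] [_ _ um] a b.
wlog ab : a b / a <= b.
  move=> H; have [|/ltW] := leP a b; first exact: H.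
  by move=> ba; rewrite distrC [leRHS]distrC; exact: H.
by rewrite uw// um// (le_trans (le_normr_Rintegral _ _))// ler_norm.
Qed.

Lemma measurable_continuousM k w : continuous k -> measurable_fun setT w ->
  measurable_fun setT (fun x => k x * w x).
Proof. by move=> ck mw; apply: measurable_funM => //;
  exact: continuous_measurable_fun. Qed.

Lemma density_continuousM_near u w m k K : continuous k ->
  has_density u w -> has_density m (fun x => `|w x|) ->
  has_density K (fun x => k x * w x) ->
  forall t e, 0 < e -> \forall y \near t,
    `|K y - K t - k t * (u y - u t)| <= e * `|m y - m t|.
Proof.
move=> ck [mw iw uw] hm [_ iK uK] t e e0.
have mnd := has_density_norm hm.
case: hm => _ im um.
have /cvgrPdist_le/(_ e e0)/nbhs_ballP[d /= d0 hd] := ck t.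
suff H a b : a <= b -> (forall x, x \in `[a, b] -> `|k t - k x| <= e) ->
    `|K b - K a - k t * (u b - u a)| <= e * (m b - m a).
  near=> y; have yd : ball t d y by near: y; exact: nbhsx_ballx.
  have [ty|/ltW yt] := leP t y.
    rewrite [X in e * X]ger0_norm ?subr_ge0 ?mnd//.
    apply: H => // x; rewrite in_itv/= => /andP[tx xy]; apply: hd.
    move: yd; rewrite /ball/= !ltr_distlC => /andP[? ?]; apply/andP; split; lra.
  rewrite -normrN (distrC (m y)) (ger0_norm (_ : 0 <= m t - m y)) ?subr_ge0 ?mnd//.
  rewrite [X in `|X|](_ : _ = K t - K y - k t * (u t - u y)); last by ring.
  apply: H => // x; rewrite in_itv/= => /andP[tx xy]; apply: hd.
  by move: yd; rewrite /ball/= !ltr_distlC => /andP[? ?]; apply/andP; split; lra.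
move=> ab hk.
rewrite uK// uw// um// -RintegralZl// -RintegralB//; last exact: integrable_EFinZ.
rewrite -RintegralZl//.
have i1 : mu.-integrable `[a, b] (EFin \o (fun x => k x * w x - k t * w x)).
  by apply: integrable_EFinB => //; exact: integrable_EFinZ.
rewrite (le_trans (le_normr_Rintegral _ _))//; apply: le_Rintegral => //.
- exact: integrable_norm.
- exact: integrable_EFinZ.
- move=> x xab; rewrite -mulrBl normrM ler_wpM2r// distrC hk//.
Unshelve. all: by end_near. Qed.

Lemma has_density_cst c : has_density (fun=> c) (fun=> 0).
Proof.
split => [|a b|a b ab]; first exact: measurable_cst.
- exact: integrable0.
- by rewrite subrr Rintegral_cst// mul0r.
Qed.

Lemma has_densityD u v w z : has_density u w -> has_density v z ->
  has_density (fun x => u x + v x) (fun x => w x + z x).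
Proof.
move=> [mw iw uw] [mz iz vz]; split => [|a b|a b ab].
- exact: measurable_funD.
- exact: integrable_EFinD.
- by rewrite RintegralD// -uw// -vz//; ring.
Qed.

Lemma has_densityZ c u w : has_density u w ->
  has_density (fun x => c * u x) (fun x => c * w x).
Proof.
move=> [mw iw uw]; split => [|a b|a b ab].
- exact: measurable_funM.
- exact: integrable_EFinZ.
- by rewrite RintegralZl// -uw//; ring.
Qed.

Lemma has_densityN u w : has_density u w ->
  has_density (fun x => - u x) (fun x => - w x).
Proof.
by move=> /(has_densityZ (-1)); apply: eq_has_density => x; rewrite mulN1r.
Qed.

Lemma has_densityB u v w z : has_density u w -> has_density v z ->
  has_density (fun x => u x - v x) (fun x => w x - z x).
Proof. by move=> uw /has_densityN; exact: has_densityD. Qed.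

Lemma has_density_id : has_density id (cst 1).
Proof.
split => [|a b|a b ab]; first exact: measurable_cst.
- apply: continuous_compact_integrable; first exact: segment_compact.
  by apply: continuous_subspaceT; exact: cst_continuous.
- rewrite Rintegral_cst// mul1r. rewrite [X in fine X]lebesgue_measure_itv/= lte_fin.
  by case: ltP => //= ba; have -> : a = b; rewrite ?subrr//; apply/eqP;
    rewrite eq_le ab ba.
Qed.

Lemma density_norm_exists u w : has_density u w ->
  exists2 m, has_density m (fun x => `|w x|) & forall a b, a <= b -> m a <= m b.
Proof.
move=> [mw iw uw].
have [m hm] : exists m, has_density m (fun x => `|w x|).
  apply: density_exists => [|a b]; first exact: measurableT_comp.
  exact: integrable_norm_itv.
by exists m => //; exact: has_density_norm hm.
Qed.

Lemma density_continuousM_exists k u w : continuous k -> has_density u w ->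
  exists K, has_density K (fun x => k x * w x).
Proof.
move=> ck [mw iw uw]; apply: density_exists; first exact: measurable_continuousM.
by move=> a b; exact: integrable_continuousM.
Qed.

Lemma has_density_translate u K w : (forall a b, u b - u a = K b - K a) ->
  has_density K w -> has_density u w.
Proof. by move=> uK [mw iw hK]; split => // a b ab; rewrite uK hK. Qed.

(** Up to two first-order errors, the increment of [u * v] minus the candidate primitive is the
    product of the increments of [u] and [v]: the first factor is small by continuity, the second is
    at most the increment of [m2]. *)
Lemma has_densityM u v w z : has_density u w -> has_density v z ->
  has_density (fun x => u x * v x) (fun x => u x * z x + v x * w x).
Proof.
move=> uw vz.
have cu := has_density_continuous uw; have cv := has_density_continuous vz.
have [m1 hm1 m1nd] := density_norm_exists uw.
have [m2 hm2 m2nd] := density_norm_exists vz.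
have [K1 hK1] := density_continuousM_exists cv uw.
have [K2 hK2] := density_continuousM_exists cu vz.
apply: (has_density_translate _ (has_densityD hK2 hK1)) => a b.
pose h x := u x * v x - (K2 x + K1 x).
suff : h a = h b by rewrite /h; lra.
apply: (@locally_negligible_variation_cst h (fun x => m1 x + m2 x)).
  by move=> x y xy; rewrite lerD ?m1nd ?m2nd.
move=> t e e0.
have e2 : 0 < e / 2 by rewrite divr_gt0.
near=> y.
have H1 : `|K1 y - K1 t - v t * (u y - u t)| <= e / 2 * `|m1 y - m1 t|.
  by near: y; exact: density_continuousM_near hm1 hK1 _ _ e2.
have H2 : `|K2 y - K2 t - u t * (v y - v t)| <= e / 2 * `|m2 y - m2 t|.
  by near: y; exact: density_continuousM_near hm2 hK2 _ _ e2.
have H3 : `|u y - u t| <= e / 2.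
  rewrite distrC; near: y; move: (cu t) => /cvgrPdist_le; exact.
have H4 := le_density_norm vz hm2 t y.
have H5 : `|(u y - u t) * (v y - v t)| <= e / 2 * `|m2 y - m2 t|.
  by rewrite normrM ler_pM.
have -> : `|m1 y + m2 y - (m1 t + m2 t)| = `|m1 y - m1 t| + `|m2 y - m2 t|.
  have [ty|/ltW yt] := leP t y.
    rewrite !ger0_norm; rewrite ?subr_ge0 ?lerD ?m1nd ?m2nd//; ring.
  rewrite !ler0_norm; rewrite ?subr_le0 ?lerD ?m1nd ?m2nd//; ring.
rewrite (_ : h y - h t = (u y - u t) * (v y - v t)
   - (K1 y - K1 t - v t * (u y - u t)) - (K2 y - K2 t - u t * (v y - v t))); last first.
  by rewrite /h; ring.
rewrite (le_trans (ler_normB _ _))// (le_trans (lerD (ler_normB _ _) (lexx _)))//.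
have : 0 <= e / 2 * `|m1 y - m1 t| by rewrite mulr_ge0// ltW.
by move: H1 H2 H5; lra.
Unshelve. all: by end_near. Qed.

Lemma has_density_comp (F F' : R -> R) u w :
  (forall x, is_derive (u x) 1 F (F' (u x))) -> continuous (F' \o u) ->
  has_density u w -> has_density (F \o u) (fun x => F' (u x) * w x).
Proof.
move=> dF cF' uw.
have cu := has_density_continuous uw.
have [m hm mnd] := density_norm_exists uw.
have [K hK] := density_continuousM_exists cF' uw.
apply: (has_density_translate _ hK) => a b.
pose h x := F (u x) - K x.
suff : h a = h b by rewrite /h/=; lra.
apply: (@locally_negligible_variation_cst h m) => // t e e0.
have e2 : 0 < e / 2 by rewrite divr_gt0.
(* The error of this expansion is relative to [|z - u t|], which for [z = u y] is at most the
   increment of [m]. *)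
have D : \forall z \near u t, `|F z - F (u t) - F' (u t) * (z - u t)| <= e / 2 * `|z -
  u t|.
  have [Fd FE] := dF t.
  have : h^-1 *: (F (h *: 1 + u t) - F (u t)) @[h --> 0^'] --> F' (u t) by rewrite -FE.
  move=> /cvgrPdist_le/(_ _ e2)/nbhs_ballP[d /= d0 hd].
  apply/nbhs_ballP; exists d => //= z zd.
  have [->|zt] := eqVneq z (u t); first by rewrite !subrr mulr0 subrr normr0 mulr0.
  have zt0 : z - u t != 0 by rewrite subr_eq0.
  have := hd (z - u t); rewrite /ball/= sub0r normrN distrC => /(_ zd zt0).
  rewrite -[_ *: 1]/(_ * _) mulr1 subrK -[_ *: _]/(_ * _) => H.
  rewrite (_ : _ - _ = (F' (u t) - (z - u t)^-1 * (F z - F (u t))) * - (z - u t)).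
    by rewrite normrM normrN (distrC z) ler_wpM2r.
  by field.
near=> y.
have H1 : `|K y - K t - F' (u t) * (u y - u t)| <= e / 2 * `|m y - m t|.
  by near: y; exact: (density_continuousM_near cF' uw hm hK _ e2).
have H2 : `|F (u y) - F (u t) - F' (u t) * (u y - u t)| <= e / 2 * `|u y - u t|.
  by near: y; exact: (cu t _ D).
have H4 := le_density_norm uw hm t y.
have H5 : e / 2 * `|u y - u t| <= e / 2 * `|m y - m t| by rewrite ler_pM2l.
rewrite (_ : h y - h t = (F (u y) - F (u t) - F' (u t) * (u y - u t))
   - (K y - K t - F' (u t) * (u y - u t))); last first.
  by rewrite /h; ring.
by rewrite (le_trans (ler_normB _ _))//; move: H1 H2 H5; lra.
Unshelve. all: by end_near. Qed.

End density.

(** * Weak derivatives and primitives *)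

Section weak_derivative.
Context {R : realType}.
Notation mu := (@lebesgue_measure R).
Implicit Types u v w k h : R -> R.

Lemma continuous_integrable_itv k (a b : R) : continuous k ->
  mu.-integrable `[a, b] (EFin \o k).
Proof.
move=> ck; apply: continuous_compact_integrable; first exact: segment_compact.
exact: continuous_subspaceT.
Qed.

Lemma continuous_density_exists k : continuous k -> exists u, has_density u k.
Proof.
move=> ck; apply: density_exists => [|a b]; first exact: continuous_measurable_fun.
exact: continuous_integrable_itv.
Qed.

Lemma has_density_is_derive u w x : has_density u w -> {for x, continuous w} ->
  is_derive x 1 u (w x).
Proof.
move=> [mw iw uw] cw.
have [||d1 d2] := @continuous_FTC1_closed R w (x - 1) x (x + 1) _ (iw _ _) _ cw; try lra.
set F := (fun y => _) in d1 d2.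
have uF : \forall y \near x, u (x - 1) + F y = u y.
  near=> y; rewrite /F -uw ?subrKC//.
  by apply: ltW; near: y; apply: lt_nbhsr; lra.
suff H : is_derive x 1 (fun y => u (x - 1) + F y) (w x).
  by apply: near_eq_is_derive H.
rewrite -[w x]add0r; apply: is_deriveD.
by rewrite -d2 derive1E; exact: derivableP.
Unshelve. all: by end_near. Qed.

Lemma density_ge0 u w : (forall x, 0 <= w x) -> has_density u w ->
  forall a b, a <= b -> u a <= u b.
Proof. by move=> w0 [_ _ uw] a b ab; rewrite -subr_ge0 uw//; exact: Rintegral_ge0. Qed.

Lemma continuous_Rintegral_eq0 k (a b : R) : continuous k -> (forall x, 0 <= k x) ->
  \int[mu]_(x in `[a, b]) k x = 0 -> forall x, a < x < b -> k x = 0.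
Proof.
move=> ck k0 ik x /andP[ax xb].
have [u hu] := continuous_density_exists ck.
have und := density_ge0 k0 hu.
have uab : u b = u a.
  have [_ _ Huw] := hu. have ab : a <= b by lra. by have := Huw a b ab; rewrite ik; lra.
have cu : \forall y \near x, cst (u a) y = u y.
  near=> y; rewrite /cst.
  have ay : a <= y by apply: ltW; near: y; apply: lt_nbhsr; lra.
  have yb : y <= b by apply: ltW; near: y; apply: lt_nbhsl; lra.
  by have := und _ _ ay; have := und _ _ yb; lra.
have H : is_derive x 1 u 0.
  exact: near_eq_is_derive cu (is_derive_cst (u a) x 1).
by have [_ <-] := has_density_is_derive hu (ck x); case: H.
Unshelve. all: by end_near. Qed.

(** The difference of the densities has zero integral over every interval, so Lebesgue
    differentiation makes it vanish almost everywhere. *)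
Lemma density_ae_unique u w z : has_density u w -> has_density u z ->
  {ae mu, forall x, w x = z x}.
Proof.
move=> uw uz.
have [md id_ d0] := has_densityB uw uz.
set d := fun x => w x - z x in md id_ d0.
have ld : locally_integrable setT d.
  split => //; first exact: openT.
  move=> K _ cK; have /compact_bounded[M [Mr HM]] := cK.
  pose N := `|M| + 1.
  have KN : K `<=` `[- N, N].
    move=> x Kx; rewrite /= in_itv/= -ler_norml.
    by apply: (HM N) => //; rewrite (le_lt_trans (ler_norm _))// ltrDl.
  have /integrableP[_] := id_ (- N) N; apply: le_lt_trans.
  apply: ge0_subset_integral => //.
  - exact: compact_measurable.
  - by apply/measurable_EFinP; apply: measurable_funTS; exact: measurableT_comp.
(* Differentiation is applied to the integral from a fixed left end [- n]; the countably many
   exceptional sets are then put together. *)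
have H n : {ae mu, forall x : R, - n%:R < x -> d x = 0}.
  have := FTC1 (f := d) (a := BLeft (- n%:R)) (fun y => id_ _ _) ld.
  apply: ae_imply => x H nx.
  have [|_ <-] := H; first by rewrite /= lte_fin.
  have F0 : \forall y \near x, cst 0 y = \int[mu]_(t in `[- n%:R, y]) d t.
    near=> y; rewrite -d0 ?subrr//; apply: ltW; near: y; exact: lt_nbhsr.
  rewrite derive1E.
  have : is_derive x 1 (fun y => \int[mu]_(t in `[- n%:R, y]) d t) 0.
    by apply: near_eq_is_derive (is_derive_cst 0 x 1).
  by case.
have := ae_foralln H; apply: ae_imply => x Hx.
apply/eqP; rewrite -subr_eq0; apply/eqP; apply: (Hx (Num.truncn `|x|).+1).
have := truncnS_gt `|x|; have := ler_norm (- x); rewrite normrN; lra.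
Unshelve. all: by end_near. Qed.


Lemma L2loc_integrable w (a b : R) : L2loc w -> mu.-integrable `[a, b] (EFin \o w).
Proof.
move=> [mw [_ _ w2]].
have i2 : mu.-integrable `[a, b] (EFin \o (fun x => 1 + w x ^+ 2)).
  apply: integrable_EFinD => //; first by apply: continuous_integrable_itv;
    exact: cst_continuous.
  apply/integrableP; split.
    by apply/measurable_EFinP; apply: measurable_funTS; exact: measurable_funX.
  by apply: w2 => //; exact: segment_compact.
apply: le_integrable i2 => //.
  by apply/measurable_EFinP; exact: measurable_funTS.
move=> x _ /=; rewrite lee_fin (ger0_norm (_ : 0 <= 1 + w x ^+ 2)) ?addr_ge0 ?sqr_ge0//.
rewrite -(real_normK (num_real (w x))).
have := sqr_ge0 (`|w x| - 1); have := normr_ge0 (w x); nra.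
Qed.

Lemma continuous_L2loc w : continuous w -> L2loc w.
Proof.
move=> cw; have cw2 : continuous (fun x => w x ^+ 2).
  by move=> x; apply: (@continuous_comp _ _ _ w (fun y => y ^+ 2));
    [exact: cw|exact: exprn_continuous].
split; first exact: continuous_measurable_fun.
split; [exact: continuous_measurable_fun|exact: openT|move=> K _ cK].
have /integrableP[_] : mu.-integrable K (EFin \o (fun x => w x ^+ 2)).
  by apply: continuous_compact_integrable => //; exact: continuous_subspaceT.
by [].
Qed.

Lemma Rintegral_support h (a b : R) : (forall x, ~ (a <= x <= b) -> h x = 0) ->
  \int[mu]_(x in setT) h x = \int[mu]_(x in `[a, b]) h x.
Proof.
move=> h0; rewrite [RHS]Rintegral_mkcond; apply: eq_Rintegral => x _.
rewrite patchE; case: ifPn => //; rewrite notin_setE/= in_itv/= => /h0 //.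
Qed.

Lemma test_function_itv (phi : R -> R) : test_function phi ->
  exists2 N, 0 < N & forall x, ~ (- N <= x <= N) -> phi x = 0 /\ (phi^`())%classic x = 0.
Proof.
move=> [dphi cphi [K /compact_bounded[M [Mr HM]] phi0]].
pose N := `|M| + 1.
have N0 x : N < `|x| -> phi x = 0.
  move=> Nx; apply: phi0 => Kx; have MN : M < N by rewrite (le_lt_trans (ler_norm M))
    ?ltrDl.
  by have /= := HM N MN x Kx; rewrite leNgt Nx.
exists (`|M| + 1) => [|x]; first by rewrite ltr_wpDl.
rewrite -ler_norml => /negP; rewrite -ltNge => Nx; split; first exact: N0.
have H : \forall y \near x, cst 0 y = phi y.
  near=> y; rewrite N0//; near: y.
  have : {for x, continuous (fun y : R => `|y|)} by exact: norm_continuous.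
  by move=> /(_ _ (lt_nbhsr Nx)).
rewrite derive1E; have : is_derive x 1 phi 0 by exact: near_eq_is_derive H
  (is_derive_cst 0 x 1).
by case.
Unshelve. all: by end_near. Qed.

Lemma test_function_density (phi : R -> R) : test_function phi ->
  has_density phi (phi^`())%classic.
Proof.
move=> [dphi cphi _].
have H : has_density (phi \o id) (fun x => (phi^`())%classic (id x) * cst 1 x).
  apply: has_density_comp has_density_id => //= x.
  by rewrite derive1E; exact: derivableP.
by apply: eq_has_density H => // x; rewrite mulr1.
Qed.

Lemma has_density_weak_derivative u w : has_density u w -> L2loc w ->
  is_L2loc_weak_derivative u w.
Proof.
move=> uw lw; split => // phi tphi.
have [N N0 HN] := test_function_itv tphi.
have cphi' : continuous (phi^`())%classic by case: tphi.
have dphi := test_function_density tphi.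
have cphi := has_density_continuous dphi.
have cu := has_density_continuous uw.
(* The extra 1 puts both end points strictly outside [[-N, N]], where [phi] vanishes, so the
   integration by parts has no boundary term. *)
rewrite (@Rintegral_support _ (- N - 1) (N + 1)); last first.
  by move=> x H; have [|_ ->] := HN x; rewrite ?mulr0//;
    apply: contra_not H => /andP[? ?]; apply/andP; split; lra.
rewrite (@Rintegral_support _ (- N - 1) (N + 1)); last first.
  by move=> x H; have [|->] := HN x; rewrite ?mulr0//;
    apply: contra_not H => /andP[? ?]; apply/andP; split; lra.
have [_ _ up] := has_densityM uw dphi.
have NN : - N - 1 <= N + 1 by lra.
have := up _ _ NN.
have [|-> _] := HN (- N - 1); first by move=> /andP[]; lra.
have [|-> _] := HN (N + 1); first by move=> /andP[]; lra.
rewrite !mulr0 subrr RintegralD//; last 2 first.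
- apply: continuous_integrable_itv ; continuity.
- by apply: integrable_continuousM => //; case: uw.
have -> : \int[mu]_(x in `[(- N - 1), (N + 1)]) (w x * phi x) =
          \int[mu]_(x in `[(- N - 1), (N + 1)]) (phi x * w x).
  by apply: eq_Rintegral => x _; rewrite mulrC.
by move=> /eqP; rewrite eq_sym addr_eq0 => /eqP.
Qed.

Lemma continuous_Rintegral_gt0 k (a b : R) : a < b -> continuous k ->
  (forall x, 0 <= k x) -> (forall x, a < x < b -> 0 < k x) ->
  0 < \int[mu]_(x in `[a, b]) k x.
Proof.
move=> ab ck k0 kgt0; rewrite lt_neqAle Rintegral_ge0// andbT.
apply/eqP => /esym/(continuous_Rintegral_eq0 ck k0) /(_ ((a + b) / 2)).
have mab : a < (a + b) / 2 < b by apply/andP; split; lra.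
by move=> /(_ mab)/eqP; rewrite gt_eqF// kgt0.
Qed.

(* The test function has derivative (g - mean of g) * bump, so that the
   hypothesis says that g has zero weighted variance. *)
Lemma orthogonal_test_derivatives_cst (g : R -> R) : continuous g ->
  (forall phi, test_function phi ->
     \int[mu]_(x in setT) (g x * (phi^`())%classic x) = 0) ->
  forall x y, g x = g y.
Proof.
move=> cg H.
suff K a b : a < b -> exists c, forall x, a < x < b -> g x = c.
  move=> x y; pose a := Num.min x y - 1; pose b := Num.max x y + 1.
  have [|c Hc] := K a b.
    by rewrite /a /b; case: (lerP x y) => ?; lra.
  by rewrite !Hc// /a /b; case: (lerP x y) => ?; apply/andP; split; lra.
move=> ab.
pose k x := Num.max 0 ((x - a) * (b - x)).
have ck : continuous k.
  have cab : continuous (fun x : R => (x - a) * (b - x) : R) by continuity.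
  move=> x; apply: (@continuous_max R _ (fun=> 0) (fun x => (x - a) * (b - x)));
    [exact: cst_continuous|exact: cab].
have k0 x : 0 <= k x by rewrite /k le_max lexx.
have kout x : ~ (a < x < b) -> k x = 0.
  move=> xab; apply/max_idPl; rewrite leNgt; apply/negP => h; apply: xab.
  by apply/andP; split; nra.
have kin x : a < x < b -> 0 < k x.
  by move=> /andP[ax xb]; rewrite /k lt_max mulr_gt0 ?orbT// subr_gt0.
pose I := \int[mu]_(x in `[a, b]) k x.
pose J := \int[mu]_(x in `[a, b]) (k x * g x).
have I0 : 0 < I by exact: continuous_Rintegral_gt0.
pose q x := k x * (I * g x - J).
have cq : continuous q by rewrite /q; continuity.
have iq : \int[mu]_(x in `[a, b]) q x = 0.
  transitivity (\int[mu]_(x in `[a, b]) (I * (k x * g x) - J * k x)).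
    by apply: eq_Rintegral => x _; rewrite /q; ring.
  have i1 : mu.-integrable `[a, b] (EFin \o (fun x => k x * g x)).
    by apply: continuous_integrable_itv; continuity.
  have i2 := continuous_integrable_itv a b ck.
  rewrite RintegralB// ?RintegralZl//; try exact: integrable_EFinZ.
  by rewrite -/I -/J mulrC subrr.
have [Phi hPhi] := continuous_density_exists cq.
pose phi x := Phi x - Phi a.
have hphi : has_density phi q.
  by apply: has_density_translate hPhi => x y; rewrite /phi; ring.
have dphi (x : R) : is_derive x 1 phi (q x) by apply: has_density_is_derive hphi (cq x).
have phi'E : (phi^`())%classic = q.
  by apply/funext => x; rewrite derive1E; case: (dphi x).
have tphi : test_function phi.
  split.
  - by move=> x; case: (dphi x).
  - by rewrite phi'E.
  - exists (`[a, b]%classic : set R); first exact: segment_compact.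
    move=> x /=; rewrite in_itv/= => xab.
    case: hPhi => _ _ hP.
    have [xa|ax] := leP x a.
      rewrite /phi -[LHS]opprK opprB hP// (_ : \int[_]_(_ in _) _ = 0) ?oppr0//.
      transitivity (\int[mu]_(y in `[x, a]) (fun=> 0) y);
        last by rewrite Rintegral_cst// mul0r.
      apply: eq_Rintegral => y; rewrite inE/= in_itv/= => /andP[xy ya].
      by rewrite /q kout ?mul0r// => /andP[]; lra.
    have bx : b <= x by rewrite leNgt; apply/negP => bx; apply: xab;
      rewrite (ltW ax) (ltW bx).
    rewrite /phi hP ?(ltW ax)// (@RintegralU_itv _ _ a b x) ?(ltW ab)//;
      last exact: continuous_integrable_itv.
    rewrite iq add0r.
    transitivity (\int[mu]_(y in `[b, x]) (fun=> 0) y);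
      last by rewrite Rintegral_cst// mul0r.
    apply: eq_Rintegral => y; rewrite inE/= in_itv/= => /andP[xy ya].
    by rewrite /q kout ?mul0r// => /andP[]; lra.
have gq : \int[mu]_(x in `[a, b]) (g x * q x) = 0.
  rewrite -(H _ tphi) phi'E; symmetry; apply: Rintegral_support => x xab.
  by rewrite /q kout ?mul0r ?mulr0// => /andP[ax xb]; apply: xab; rewrite !ltW.
have : \int[mu]_(x in `[a, b]) (k x * (I * g x - J) ^+ 2) = 0.
  transitivity (\int[mu]_(x in `[a, b]) (I * (g x * q x) - J * q x)).
    by apply: eq_Rintegral => x _; rewrite /q; ring.
  have i1 : mu.-integrable `[a, b] (EFin \o (fun x => g x * q x)).
    by apply: continuous_integrable_itv; continuity.
  have i2 := continuous_integrable_itv a b cq.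
  rewrite RintegralB// ?RintegralZl//; try exact: integrable_EFinZ.
  by rewrite gq iq !mulr0 subrr.
have c2 : continuous (fun x : R => k x * (I * g x - J) ^+ 2 : R).
  by continuity.
move=> /(continuous_Rintegral_eq0 c2) HH; exists (J / I) => x xab.
have /eqP := HH (fun y => mulr_ge0 (k0 y) (sqr_ge0 _)) x xab.
rewrite mulf_eq0 gt_eqF ?kin//= sqrf_eq0 subr_eq0 => /eqP <-.
by rewrite mulrAC mulfV ?mul1r// gt_eqF.
Qed.

(** Du Bois-Reymond: [u] and a primitive [W] of [w] have the same weak derivative, so [u - W] is
    orthogonal to all derivatives of test functions. *)
Lemma weak_derivative_has_density u w : continuous u ->
  is_L2loc_weak_derivative u w -> has_density u w.
Proof.
move=> cu [lw H]; have mw : measurable_fun setT w by case: lw.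
have [W hW] := density_exists mw (fun a b => L2loc_integrable a b lw).
have cW := has_density_continuous hW.
apply: (has_density_translate _ hW) => a b.
suff : u b - W b = u a - W a by lra.
apply: (@orthogonal_test_derivatives_cst (fun x => u x - W x)).
  by continuity.
move=> phi tphi.
have [_ HW] := has_density_weak_derivative hW lw.
have [N N0 HN] := test_function_itv tphi.
have := H _ tphi; rewrite -HW//.
have cphi' : continuous (phi^`())%classic by case: tphi.
rewrite !(@Rintegral_support _ (- N) N); try by move=> x /HN[_ ->]; rewrite mulr0.
move=> E; transitivity (\int[mu]_(x in `[(- N), N])
   (u x * (phi^`())%classic x - W x * (phi^`())%classic x)).
  by apply: eq_Rintegral => x _; rewrite mulrBl.
rewrite RintegralB// ?E ?subrr//; apply: continuous_integrable_itv; continuity.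
Qed.

Lemma H1loc_has_density u : H1loc u -> has_density u (weak_derivative u).
Proof.
move=> [cu _ [w hw]]; apply: weak_derivative_has_density => //.
exact: (@xgetPex _ (fun=> 0) [set w | is_L2loc_weak_derivative u w] (ex_intro _ w hw)).
Qed.

Lemma has_density_H1loc u w : has_density u w -> L2loc w -> H1loc u.
Proof.
move=> uw lw; split; first exact: has_density_continuous uw.
  by apply: continuous_L2loc; exact: has_density_continuous uw.
by exists w; exact: has_density_weak_derivative.
Qed.

Lemma weak_derivative_ae u w : has_density u w -> L2loc w ->
  {ae mu, forall x, weak_derivative u x = w x}.
Proof.
move=> uw lw; apply: (density_ae_unique _ uw); apply: H1loc_has_density.
exact: has_density_H1loc uw lw.
Qed.

End weak_derivative.

(** * Polar form *)

Section polar.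
Context {R : realType}.
Notation mu := (@lebesgue_measure R).

Lemma has_density_measurable (u w : R -> R) : has_density u w -> measurable_fun setT w.
Proof. by case. Qed.

Lemma has_density_cos (phi f : R -> R) : has_density phi f ->
  has_density (fun x => cos (phi x)) (fun x => - sin (phi x) * f x).
Proof.
move=> hphi; have cphi := has_density_continuous hphi.
apply: (@has_density_comp _ cos (fun t => - sin t) phi f) => //.
apply: continuous_opp; apply: continuous_compose => //; exact: continuous_sin.
Qed.

Lemma has_density_sin (phi f : R -> R) : has_density phi f ->
  has_density (fun x => sin (phi x)) (fun x => cos (phi x) * f x).
Proof.
move=> hphi; have cphi := has_density_continuous hphi.
apply: (@has_density_comp _ sin cos phi f) => //.
apply: continuous_compose => //; exact: continuous_cos.
Qed.

Lemma modulus_sq (z : R[i]) : modulus z ^+ 2 = complex.Re z ^+ 2 + complex.Im z ^+ 2.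
Proof. by case: z => a b; rewrite /modulus /= sqr_sqrtr// addr_ge0 ?sqr_ge0. Qed.

Lemma modulus_ge0 (z : R[i]) : 0 <= modulus z.
Proof. by case: z => a b; exact: sqrtr_ge0. Qed.

Lemma H1locC_modulus_continuous (v : R -> R[i]) : H1locC v ->
  continuous (fun x => modulus (v x)).
Proof.
move=> [[c1 _ _] [c2 _ _]].
have -> : (fun x => modulus (v x)) =
    (fun x => Num.sqrt (complex.Re (v x) ^+ 2 + complex.Im (v x) ^+ 2)).
  by apply/funext => x; case: (v x).
apply: (@continuous_compose _ (fun x => _ + _) Num.sqrt); last exact: sqrt_continuous.
by continuity.
Qed.

Lemma ae_eq_Rintegral (h k : R -> R) : measurable_fun setT h -> measurable_fun setT k ->
  {ae mu, forall x, h x = k x} ->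
  \int[mu]_(x in setT) h x = \int[mu]_(x in setT) k x.
Proof.
move=> mh mk hk; congr fine; apply: ae_eq_integral => //; [exact/measurable_EFinP..|].
by apply: ae_imply hk => x /= ->.
Qed.

(* Without a phase, [phase v] is the junk value 0 and the momentum vanishes. *)
Lemma momentum_phase (v : R -> R[i]) : H1locC v -> momentum v != 0 ->
  is_phase v (phase v).
Proof.
move=> Hv; rewrite /momentum /phase; case: xgetP => [phi -> //|noph].
case/eqP.
have d0 : has_density (fun=> 0) (fun=> 0) := @has_density_cst R 0.
have l0 : L2loc (fun _ : R => 0) by apply: continuous_L2loc; exact: continuous_constant.
have ae0 := weak_derivative_ae d0 l0.
have mwd := has_density_measurable (H1loc_has_density (has_density_H1loc d0 l0)).
have cm := H1locC_modulus_continuous Hv.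
rewrite (@ae_eq_Rintegral _ (fun=> 0)) ?Rintegral_cst ?mul0r ?mulr0//.
- apply: measurable_continuousM => //.
  by continuity.
- by apply: ae_imply ae0 => x ->; rewrite mulr0.
Qed.

(** [r] and [f] are representatives of rho' and phi'. Energy and momentum are expressed by [rho],
    [r] and [f] alone, so the estimates can be made without [v]. *)
Definition polar_form (v : R -> R[i]) (rho r phi f : R -> R) : Prop :=
  [/\ has_density rho r, has_density phi f, forall x, 0 <= rho x,
      forall x, v x = (rho x)%:C * expi (phi x) &
      energy v = (\int[mu]_(x in setT) (2^-1 * (r x ^+ 2 + (rho x * f x) ^+ 2)
                   + 4^-1 * (1 - rho x ^+ 2) ^+ 2)%:E)%E /\
      momentum v = 2^-1 * \int[mu]_(x in setT) ((1 - rho x ^+ 2) * f x)].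

Lemma phase_components (v : R -> R[i]) phi : is_phase v phi -> forall x,
  complex.Re (v x) = modulus (v x) * cos (phi x) /\
  complex.Im (v x) = modulus (v x) * sin (phi x).
Proof. by move=> [_ vE] x; split; rewrite {1}vE /=; ring. Qed.

(** The function [Im v * cos phi - Re v * sin phi] is identically zero; the product rule gives it a
    density equal to the difference of the two sides. *)
Lemma phase_weak_derivative_ae (v : R -> R[i]) phi : H1locC v -> is_phase v phi ->
  {ae mu, forall x, modulus (v x) * weak_derivative phi x =
     cos (phi x) * complex.Im (weak_derivativeC v x) - sin (phi x) * complex.Re
       (weak_derivativeC v x)}.
Proof.
move=> [H1 H2] Hphase; have [Hphi _] := Hphase; have vE := phase_components Hphase.
have h1 := H1loc_has_density H1; have h2 := H1loc_has_density H2.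
have hphi := H1loc_has_density Hphi.
have hc := has_density_cos hphi; have hs := has_density_sin hphi.
have h0 : has_density (fun=> 0) (fun x => cos (phi x) * complex.Im (weak_derivativeC v x)
    - sin (phi x) * complex.Re (weak_derivativeC v x) - modulus (v x) * weak_derivative
      phi x).
  have := has_densityB (has_densityM h2 hc) (has_densityM h1 hs).
  apply: eq_has_density => x; have [-> ->] := vE x; first by ring.
  rewrite -[modulus (v x) * weak_derivative phi x]mulr1 -(cos2Dsin2 (phi x)) /=; ring.
apply: ae_imply (density_ae_unique h0 (has_density_cst 0)) => x /eqP.
by rewrite subr_eq0 => /eqP.
Qed.

Lemma polar_form_exists (v : R -> R[i]) : H1locC v -> is_phase v (phase v) ->
  exists rho r phi f, polar_form v rho r phi f.
Proof.
move=> Hv Hphase; have ae0 := phase_weak_derivative_ae Hv Hphase.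
have [Hphi vE] := Hphase; have vE12 := phase_components Hphase.
have cm := H1locC_modulus_continuous Hv.
case: (Hv) => H1 H2.
have h1 := H1loc_has_density H1; have h2 := H1loc_has_density H2.
have hphi := H1loc_has_density Hphi.
rewrite /weak_derivativeC /= in ae0.
set v1 := fun x => complex.Re (v x) in H1 h1 ae0.
set v2 := fun x => complex.Im (v x) in H2 h2 ae0.
set w1 := weak_derivative v1 in h1 ae0; set w2 := weak_derivative v2 in h2 ae0.
set phi := phase v in vE vE12 hphi ae0; set f := weak_derivative phi in hphi ae0.
pose rho x := modulus (v x).
have hc := has_density_cos hphi; have hs := has_density_sin hphi.
(* The radial component of v'. The terms with [f] in the product rule cancel, because [v] is
   parallel to [expi phi]. *)
pose r x := cos (phi x) * w1 x + sin (phi x) * w2 x.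
have hrho : has_density rho r.
  have := has_densityD (has_densityM h1 hc) (has_densityM h2 hs).
  apply: eq_has_density => x; rewrite /v1 /v2; have [-> ->] := vE12 x.
    transitivity (rho x * (cos (phi x) ^+ 2 + sin (phi x) ^+ 2));
      first by rewrite /rho; ring.
    by rewrite cos2Dsin2 mulr1.
  by rewrite /r; ring.
exists rho, r, phi, f; split => //; first by move=> x; exact: modulus_ge0.
split => //.
have [mr mf] := (has_density_measurable hrho, has_density_measurable hphi).
have [m1 m2] := (has_density_measurable h1, has_density_measurable h2).
have EE x : energy_density v x = 2^-1 * (w1 x ^+ 2 + w2 x ^+ 2) + 4^-1 * (1 - rho x ^+
  2) ^+ 2.
  by rewrite /energy_density modulus_sq.
rewrite /energy; apply: ae_eq_integral => //.
- apply/measurable_EFinP; rewrite (funext EE); apply: measurable_funD.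
    by apply: measurable_funM => //; apply: measurable_funD; exact: measurable_funX.
  by apply: continuous_measurable_fun; continuity.
- apply/measurable_EFinP; apply: measurable_funD.
    apply: measurable_funM => //; apply: measurable_funD; apply: measurable_funX => //.
    by apply: measurable_funM => //; exact: continuous_measurable_fun.
  by apply: continuous_measurable_fun; continuity.
apply: ae_imply ae0 => x + _; rewrite EE /r -/(rho x) => ->.
congr (_%:E); congr (_ * _ + _).
rewrite -[LHS]mulr1 -(cos2Dsin2 (phi x)); ring.
Qed.

End polar.

(** * Integrals over the line *)

Section line_integrals.
Context {R : realType}.
Notation mu := (@lebesgue_measure R).
Implicit Types F f : R -> R.

Lemma bigcup_symmetric_itv : \bigcup_n (`[- n%:R, n%:R]%classic : set R) = setT.
Proof.
apply/seteqP; split => // x _; exists (Num.truncn `|x|).+1 => //=.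
by rewrite in_itv/= -ler_norml ltW// truncnS_gt.
Qed.

Lemma has_density_integral F f (a b : R) : has_density F f -> a <= b ->
  (\int[mu]_(x in `[a, b]) (f x)%:E)%E = (F b - F a)%:E.
Proof.
by move=> [mf i_f Ff] ab; rewrite Ff// /Rintegral fineK//; exact: integrable_fin_num.
Qed.

Lemma opp_natr_le n : - n%:R <= n%:R :> R.
Proof. by rewrite (le_trans (_ : _ <= 0)) ?oppr_le0. Qed.

Lemma ge0_density_cvg F f : has_density F f -> (forall x, 0 <= f x) ->
  ((F n%:R - F (- n%:R))%:E @[n --> \oo] --> \int[mu]_(x in setT) (f x)%:E)%E.
Proof.
move=> hF f0; have [mf i_f Ff] := hF.
under eq_cvg do rewrite -(has_density_integral hF (opp_natr_le _)).
rewrite -bigcup_symmetric_itv; apply: ge0_nondecreasing_set_cvg_integral => //.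
- apply/nondecreasing_seqP => n; rewrite subsetEset; apply: subset_itv; rewrite bnd_simp.
    by rewrite lerN2 ler_nat.
  by rewrite ler_nat.
- by move=> n; apply/measurable_EFinP; exact: measurable_funTS.
- by move=> n x _; rewrite lee_fin.
Qed.

Lemma ge0_density_integral F f A B : has_density F f -> (forall x, 0 <= f x) ->
  F n%:R @[n --> \oo] --> B -> F (- n%:R) @[n --> \oo] --> A ->
  (\int[mu]_(x in setT) (f x)%:E)%E = (B - A)%:E.
Proof.
move=> hF f0 FB FA.
have H1 := ge0_density_cvg hF f0.
have H2 : ((F n%:R - F (- n%:R))%:E @[n --> \oo] --> (B - A)%:E)%E.
  by apply: cvg_EFin; [exact: nearW|exact: cvgB].
exact: (cvg_unique _ H1 H2).
Qed.

(** Writing f as [(f + |f|) - |f|] reduces the claim to nonnegative densities, where it is monotone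
    convergence. *)
Lemma integrable_density_cvg F f : has_density F f -> mu.-integrable setT (EFin \o f) ->
  F n%:R - F (- n%:R) @[n --> \oo] --> \int[mu]_(x in setT) f x.
Proof.
move=> hF i_f.
have i_n := integrable_norm i_f.
have [M hM _] := density_norm_exists hF.
have key G g : has_density G g -> (forall x, 0 <= g x) ->
  mu.-integrable setT (EFin \o g) ->
    G n%:R - G (- n%:R) @[n --> \oo] --> \int[mu]_(x in setT) g x.
  move=> hG g0 i_g; have H := ge0_density_cvg hG g0.
  have : ((G n%:R - G (- n%:R))%:E @[n --> \oo] --> (\int[mu]_(x in setT) g x)%:E)%E.
    by rewrite /Rintegral fineK//; exact: integrable_fin_num.
  exact: fine_cvg.
have i_s : mu.-integrable setT (EFin \o (fun x => f x + `|f x|)) by exact: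
  integrable_EFinD.
have H1 := key _ _ hM (fun x => normr_ge0 _) i_n.
have H2 := key _ _ (has_densityD hF hM) _ i_s.
have -> : \int[mu]_(x in setT) f x =
    \int[mu]_(x in setT) (f x + `|f x|) - \int[mu]_(x in setT) `|f x|.
  by rewrite -RintegralB//; apply: eq_Rintegral => x _; rewrite addrK.
have fM0 x : 0 <= f x + `|f x| by have := ler_norm (- f x); rewrite normrN; lra.
under eq_cvg => n.
  rewrite (_ : F n%:R - F (- n%:R) =
    F n%:R + M n%:R - (F (- n%:R) + M (- n%:R)) - (M n%:R - M (- n%:R))); last by ring.
  over.
by apply: cvgB; [exact: H2|exact: H1].
Qed.

End line_integrals.

(** * The travelling wave *)

Section tanh.
Context {R : realType}.
Implicit Types x : R.

Lemma expRDN_gt0 x : 0 < expR x + expR (- x).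
Proof. by rewrite addr_gt0 ?expR_gt0. Qed.

Lemma is_derive_tanh x : is_derive x 1 (@tanh R) (1 - tanh x ^+ 2).
Proof.
have D0 := lt0r_neq0 (expRDN_gt0 x).
have dN : is_derive x 1 (fun y => expR (- y)) (- expR (- x)).
  by apply: trigger_derive; rewrite mulrN1.
have dD : is_derive x 1 (fun y => expR y + expR (- y)) (expR x - expR (- x)) by exact:
  is_deriveD.
have dB : is_derive x 1 (fun y => expR y - expR (- y)) (expR x + expR (- x)).
  by rewrite -[X in _ + X]opprK; exact: is_deriveB.
have dV := @is_deriveV R (fun y => expR y + expR (- y)) x _ 1 D0 dD.
have := is_deriveM dB dV.
move=> /is_derive_eq; apply.
by rewrite /tanh /GRing.scale /=; field.
Qed.

Lemma tanhN x : tanh (- x) = - tanh x.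
Proof. by rewrite /tanh opprK [X in _ / X]addrC -mulNr opprB. Qed.

Lemma one_sub_tanh x : 1 - tanh x = 2 * expR (- x) / (expR x + expR (- x)).
Proof. by have D0 := lt0r_neq0 (expRDN_gt0 x); rewrite /tanh; field. Qed.

Lemma tanh_lt1 x : tanh x < 1.
Proof.
by rewrite -subr_gt0 one_sub_tanh divr_gt0 ?expRDN_gt0// mulr_gt0 ?expR_gt0.
Qed.

Lemma tanh_gtN1 x : -1 < tanh x.
Proof. by have := tanh_lt1 (- x); rewrite tanhN; lra. Qed.

Lemma tanh_ge0 x : 0 <= x -> 0 <= tanh x.
Proof.
move=> x0; rewrite /tanh divr_ge0 ?(ltW (expRDN_gt0 x))// subr_ge0 ler_expR; lra.
Qed.

Lemma one_sub_tanh_le x : 0 <= x -> 1 - tanh x <= (1 + x)^-1.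
Proof.
move=> x0; rewrite one_sub_tanh ler_pdivrMr ?expRDN_gt0// [leRHS]mulrC ler_pdivlMr;
  last by lra.
have := expR_ge1Dx x; have := expRxMexpNx_1 x; have := expR_gt0 x; have := expR_gt0 (- x).
move: (expR x) (expR (- x)) => a b b0 a0 ab1 ax; nra.
Qed.

Lemma cvgy_tanh : @tanh R x @[x --> +oo] --> (1 : R).
Proof.
apply/cvgrPdist_le => e e0; near=> x.
have x0 : 0 <= x by near: x; exact: nbhs_pinfty_ge.
rewrite ger0_norm ?subr_ge0 ?(ltW (tanh_lt1 _))//.
rewrite (le_trans (one_sub_tanh_le x0))// invf_ple ?posrE//; last by lra.
suff : e^-1 <= x by lra.
by near: x; apply: nbhs_pinfty_ge; rewrite num_real.
Unshelve. all: by end_near. Qed.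

End tanh.

(** * Energy, momentum and phase of the wave of speed [sqrt 2 * m] *)

Section wave.
Context {R : realType}.
Notation mu := (@lebesgue_measure R).
Context (s m : R).
Context (s0 : 0 < s) (m0 : 0 < m) (sm : s ^+ 2 + m ^+ 2 = 1).

Let sqrt2_gt0 : 0 < Num.sqrt 2 :> R. Proof. by rewrite sqrtr_gt0. Qed.
Let sqrt2_sq : Num.sqrt 2 ^+ 2 = 2 :> R. Proof. by rewrite sqr_sqrtr. Qed.

Let sqrt2_half : Num.sqrt 2 / 2 = (Num.sqrt 2)^-1 :> R.
Proof.
apply: (mulIf (lt0r_neq0 sqrt2_gt0)).
by rewrite mulVf ?gt_eqF// mulrAC -expr2 sqrt2_sq divff.
Qed.

(** The real part of the wave, whose imaginary part is the constant [- m]; the squared modulus is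
    [profile ^ 2 + m ^ 2] and tends to [s ^ 2 + m ^ 2 = 1]. *)
Definition profile (x : R) : R := s * tanh (s / Num.sqrt 2 * x).

Lemma has_density_profile : has_density profile (fun x => (s ^+ 2 - profile x ^+ 2) /
  Num.sqrt 2).
Proof.
have h1 := has_densityZ (s / Num.sqrt 2) (@has_density_id R).
have ct : continuous (@tanh R).
  by move=> x; apply/differentiable_continuous/derivable1_diffP; case: (is_derive_tanh x).
have c2 : continuous (fun x : R => 1 - tanh (s / Num.sqrt 2 * x) ^+ 2).
  have c1 : continuous (fun x : R => tanh (s / Num.sqrt 2 * x)).
    by apply: (@continuous_compose _ (fun x => s / Num.sqrt 2 * x) (@tanh R)) => //;
      continuity.
  by continuity.
have := has_densityZ s (@has_density_comp _ (@tanh R) (fun y => 1 - tanh y ^+ 2)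
  (fun x => s / Num.sqrt 2 * x) _ (fun x => is_derive_tanh _) c2 h1).
apply: eq_has_density => x; rewrite /profile//=; field.
by rewrite gt_eqF.
Qed.

Lemma profile_sq_lt x : profile x ^+ 2 < s ^+ 2.
Proof.
rewrite /profile exprMn -[ltRHS]mulr1 ltr_pM2l ?exprn_gt0//.
have := tanh_lt1 (s / Num.sqrt 2 * x); have := tanh_gtN1 (s / Num.sqrt 2 * x); nra.
Qed.

Lemma profileN x : profile (- x) = - profile x.
Proof. by rewrite /profile mulrN tanhN mulrN. Qed.

Lemma cvg_profile (b : R) : profile (n%:R + b) @[n --> \oo] --> s.
Proof.
have k0 : 0 < s / Num.sqrt 2 by exact: divr_gt0.
have H : (s / Num.sqrt 2 * (n%:R + b)) @[n --> \oo] --> +oo.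
  apply/cvgryPge => A; near=> n.
  rewrite -ler_pdivrMl// -lerBlDr.
  by near: n; exact: nbhs_infty_ger.
rewrite -[X in _ --> X]mulr1; apply: cvgM; first exact: cvg_cst.
exact: cvg_comp H cvgy_tanh.
Unshelve. all: by end_near. Qed.

Lemma wave_re x : complex.Re (travelling_wave (Num.sqrt 2 * m) x) = profile x.
Proof.
rewrite /travelling_wave /= exprMn sqrt2_sq /profile.
have E : 2 - 2 * m ^+ 2 = 2 * s ^+ 2 by have := sm; lra.
rewrite E (mulrC 2) mulfK// (sqrtrM _ (sqr_ge0 s)) sqrtr_sqr gtr0_norm//.
have -> : s * Num.sqrt 2 / 2 = s / Num.sqrt 2.
  by rewrite -mulrA sqrt2_half.
by ring.
Qed.

Lemma wave_im x : complex.Im (travelling_wave (Num.sqrt 2 * m) x) = - m.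
Proof. by rewrite /travelling_wave /= [Num.sqrt 2 * m]mulrC mulfK ?gt_eqF//; ring. Qed.


Let v := travelling_wave (Num.sqrt 2 * m).
Let X := profile.

(** Change of variable y = X x: the second factor is X', and X runs from [- s] to [s]. Integrals
    along the wave thus reduce to end values of an antiderivative in y. *)
Lemma profile_integral (F F' : R -> R) : (forall y : R, is_derive y 1 F (F' y)) ->
  continuous F' -> (forall x, 0 <= F' (X x)) ->
  (\int[mu]_(x in setT) (F' (X x) * ((s ^+ 2 - X x ^+ 2) / Num.sqrt 2))%:E)%E =
  (F s - F (- s))%:E.
Proof.
move=> dF cF' F'0; have hX := has_density_profile.
have cX := has_density_continuous hX.
have cF (y : R) : {for y, continuous F}.
  by apply/differentiable_continuous/derivable1_diffP; case: (dF y).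
apply: (@ge0_density_integral _ (F \o X)).
- by apply: has_density_comp hX => //; exact: continuous_compose.
- move=> x; rewrite mulr_ge0// divr_ge0 ?(ltW sqrt2_gt0)// subr_ge0 ltW//.
  exact: profile_sq_lt.
- have cN : X n%:R @[n --> \oo] --> s by under eq_cvg do rewrite -[_%:R]addr0;
  exact: cvg_profile.
  exact: cvg_comp cN (cF s).
- have cN : X (- n%:R) @[n --> \oo] --> - s.
    under eq_cvg do rewrite /X profileN -[_%:R]addr0; apply: cvgN; exact: cvg_profile.
  exact: cvg_comp cN (cF (- s)).
Qed.

Let ReE : (fun x => complex.Re (v x)) = X. Proof. by apply/funext => x;
  exact: wave_re. Qed.
Let ImE : (fun x => complex.Im (v x)) = cst (- m). Proof. by apply/funext => x;
  exact: wave_im. Qed.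

Let continuous_profile : continuous X.
Proof. exact: has_density_continuous has_density_profile. Qed.

Let continuous_profile_slope : continuous (fun x => (s ^+ 2 - X x ^+ 2) / Num.sqrt 2).
Proof. by have cX := continuous_profile; continuity. Qed.

Lemma wave_modulus_sq x : modulus (v x) ^+ 2 = X x ^+ 2 + m ^+ 2.
Proof. by rewrite modulus_sq wave_re wave_im sqrrN. Qed.

Lemma wave_H1locC : H1locC v.
Proof.
split; rewrite ?ReE ?ImE.
  by apply: (has_density_H1loc has_density_profile); exact: continuous_L2loc.
by apply: (has_density_H1loc (has_density_cst _));
  exact: (continuous_L2loc (@continuous_constant R 0)).
Qed.

Let wave_derivative : {ae mu, forall x, weak_derivativeC v x =
  ((s ^+ 2 - X x ^+ 2) / Num.sqrt 2) +i* 0}.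
Proof.
have a1 := weak_derivative_ae has_density_profile (continuous_L2loc
  continuous_profile_slope).
have a2 := weak_derivative_ae (has_density_cst (- m)) (continuous_L2loc
  (@continuous_constant R 0)).
have := @filterI _ _ (ae_filter_ringOfSetsType mu) _ _ a1 a2.
by apply: ae_imply => x [H1 H2]; rewrite /weak_derivativeC ReE ImE H1 H2.
Qed.

Lemma wave_energy : energy v = (2 * Num.sqrt 2 / 3 * s ^+ 3)%:E.
Proof.
(* Along the wave the kinetic and potential parts of the energy density are equal, so the density is
   X' ^ 2; [F'] is X' written as a function of y = X. *)
pose F (y : R) := (s ^+ 2 * y - y ^+ 3 / 3) / Num.sqrt 2.
pose F' (y : R) := (s ^+ 2 - y ^+ 2) / Num.sqrt 2.
have -> : 2 * Num.sqrt 2 / 3 * s ^+ 3 = F s - F (- s).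
  by rewrite /F -sqrt2_half; field.
have dF (y : R) : is_derive y 1 F (F' y).
  rewrite /F /F'; apply: trigger_derive.
  by rewrite /GRing.scale /=; field; rewrite gt_eqF.
have cF' : continuous F' by rewrite /F'; continuity.
have F'0 x : 0 <= F' (X x).
  by rewrite /F' divr_ge0 ?(ltW sqrt2_gt0)// subr_ge0 ltW// profile_sq_lt.
rewrite -(profile_integral dF cF' F'0).
rewrite /energy; have [HR HI] := wave_H1locC.
have mR := has_density_measurable (H1loc_has_density HR).
have mI := has_density_measurable (H1loc_has_density HI).
apply: ae_eq_integral => //.
- apply/measurable_EFinP; apply: measurable_funD.
    apply: measurable_funM => //.
    rewrite (_ : (fun x => modulus (weak_derivativeC v x) ^+ 2) = fun x =>
      weak_derivative (fun y => complex.Re (v y)) x ^+ 2 +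
      weak_derivative (fun y => complex.Im (v y)) x ^+ 2).
      by apply: measurable_funD; exact: measurable_funX.
    by apply/funext => x; rewrite modulus_sq.
  apply: continuous_measurable_fun.
  by have cm := H1locC_modulus_continuous wave_H1locC; continuity.
- apply/measurable_EFinP; apply: continuous_measurable_fun.
  by have cX := continuous_profile; rewrite /F'; continuity.
- apply: ae_imply wave_derivative => x H _; congr (_%:E).
  rewrite /energy_density wave_modulus_sq H modulus_sq /= /F'.
  have -> : 1 - (X x ^+ 2 + m ^+ 2) = s ^+ 2 - X x ^+ 2 by rewrite -sm; ring.
  rewrite -[RHS]expr2 expr_div_n sqrt2_sq.
  by field.
Qed.

Let sq_gt0 y : 0 < y ^+ 2 + m ^+ 2.
Proof. by rewrite ltr_wpDl ?sqr_ge0// exprn_gt0. Qed.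

(** The wave runs in the lower half plane, so its angle is measured from the direction of [-i],
    where [atan] describes it without a jump. *)
Definition wave_phase (x : R) : R := atan (profile x / m) - pi / 2.

Lemma has_density_wave_phase : has_density wave_phase
  (fun x => m * (s ^+ 2 - X x ^+ 2) / (Num.sqrt 2 * (X x ^+ 2 + m ^+ 2))).
Proof.
have c1 : continuous (fun y : R => (1 + (y / m) ^+ 2)^-1).
  apply: continuous_inv; first by continuity.
  by move=> y; rewrite gt_eqF// ltr_pwDl// sqr_ge0.
have h1 := has_densityZ m^-1 has_density_profile.
have h2 := @has_density_comp _ (@atan R) (fun y => (1 + y ^+ 2)^-1) (fun x => m^-1 * X x)
  _ (fun x => is_derive1_atan _) _ h1.
have := has_densityB (h2 _) (has_density_cst (pi / 2)).
have c2 : continuous ((fun y : R => (1 + y ^+ 2)^-1) \o (fun x : R => m^-1 * X x)).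
  apply: continuous_inv; first by have cX := continuous_profile; rewrite /=; continuity.
  by move=> y; rewrite gt_eqF// ltr_pwDl// sqr_ge0.
move=> /(_ c2); apply: eq_has_density => x /=; first by rewrite /wave_phase mulrC.
have := sq_gt0 (X x) => /lt0r_neq0 D0.
have D1 : 1 + (m^-1 * X x) ^+ 2 != 0 by rewrite gt_eqF// ltr_pwDl// sqr_ge0.
have m1 := lt0r_neq0 m0; have q1 := lt0r_neq0 sqrt2_gt0.
rewrite (_ : 1 + (m^-1 * X x) ^+ 2 = (X x ^+ 2 + m ^+ 2) / m ^+ 2); last by field.
rewrite -/X; field; by rewrite D0 q1 m1.
Qed.

Lemma wave_polar x : v x = (modulus (v x))%:C * expi (wave_phase x).
Proof.
have E : modulus (v x) = m * Num.sqrt (1 + (X x / m) ^+ 2).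
  apply/eqP; rewrite -(@eqrXn2 _ 2) ?modulus_ge0 ?mulr_ge0 ?sqrtr_ge0 ?ltW//.
  rewrite wave_modulus_sq [(m * _) ^+ 2]exprMn sqr_sqrtr ?addr_ge0 ?sqr_ge0//.
  by apply/eqP; field; rewrite gt_eqF.
have D0 : Num.sqrt (1 + (X x / m) ^+ 2) != 0.
  by rewrite gt_eqF// sqrtr_gt0 ltr_pwDl// sqr_ge0.
have c0 : cos (atan (X x / m)) = (Num.sqrt (1 + (X x / m) ^+ 2))^-1 by rewrite cos_atan.
have s0' : sin (atan (X x / m)) = X x / m * (Num.sqrt (1 + (X x / m) ^+ 2))^-1.
  have := congr1 (fun z => z * cos (atan (X x / m))) (atanK (X x / m)).
  by rewrite /tan divfK c0 ?invr_neq0.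
have m1 := lt0r_neq0 m0.
rewrite [LHS]complexE [RHS]complexE; congr (_%:C + _ * _%:C).
  rewrite wave_re -/X E /= mul0r subr0 /wave_phase cosB cos_pihalf sin_pihalf.
  by rewrite mulr0 add0r mulr1 s0'; field; rewrite ?m1 ?D0.
rewrite wave_im E /= mul0r addr0 /wave_phase sinB cos_pihalf sin_pihalf.
by rewrite mulr0 sub0r mulr1 c0; field; rewrite ?m1 ?D0.
Qed.

(** Here [wave_phase] serves as a witness that the choice in [phase] does not fall back on its
    default. The momentum is then computed for the chosen phase, through
    [phase_weak_derivative_ae]. *)
Lemma wave_is_phase : is_phase v (phase v).
Proof.
apply: (@xgetPex _ (fun=> 0) [set phi | is_phase v phi]); exists wave_phase; split;
  last exact: wave_polar.
apply: (has_density_H1loc has_density_wave_phase); apply: continuous_L2loc.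
have cX := continuous_profile; apply: continuous_mul; first by continuity.
apply: continuous_inv; first by continuity.
by move=> x; rewrite mulf_neq0 ?gt_eqF.
Qed.

Lemma wave_momentum : momentum v = atan (s / m) - s * m.
Proof.
(* The momentum density is X' times [m * (s ^ 2 - y ^ 2) / (y ^ 2 + m ^ 2)] at y = X, and this
   quotient equals [m / (y ^ 2 + m ^ 2) - m] because [s ^ 2 + m ^ 2 = 1]. *)
pose F (y : R) := atan (y / m) - m * y.
pose F' (y : R) := (1 + (y / m) ^+ 2)^-1 / m - m.
have D1 (y : R) : 1 + (y / m) ^+ 2 != 0 by rewrite gt_eqF// ltr_pwDl// sqr_ge0.
have F'E y : F' y = m * (s ^+ 2 - y ^+ 2) / (y ^+ 2 + m ^+ 2).
  rewrite /F' (_ : 1 + (y / m) ^+ 2 = (y ^+ 2 + m ^+ 2) / m ^+ 2); last by field;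
    rewrite gt_eqF.
  rewrite (_ : s ^+ 2 - y ^+ 2 = 1 - (y ^+ 2 + m ^+ 2)); last by rewrite -sm; ring.
  by field; rewrite !gt_eqF.
have -> : atan (s / m) - s * m = 2^-1 * (F s - F (- s)).
  by rewrite /F mulNr atanN; field.
have cF' : continuous F' by rewrite /F'; continuity; apply: continuous_inv => //;
  continuity.
have dF (y : R) : is_derive y 1 F (F' y).
  rewrite /F /F'; apply: is_deriveB.
    have : is_derive y 1 (atan \o (fun y => y / m)) ((1 + (y / m) ^+ 2)^-1 * m^-1).
      by apply: is_derive1_comp; apply: trigger_derive; rewrite /GRing.scale /=; ring.
    by [].
  by apply: trigger_derive; rewrite /GRing.scale /=; ring.
have F'0 x : 0 <= F' (X x).
  rewrite F'E divr_ge0 ?(ltW (sq_gt0 _))// mulr_ge0 ?(ltW m0)// subr_ge0 ltW//.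
  exact: profile_sq_lt.
have I := profile_integral dF cF' F'0; rewrite /momentum; congr (_ * _).
rewrite -[RHS]/(fine (F s - F (- s))%:E) -I -/(Rintegral mu setT _).
have Hv := wave_H1locC.
have cX := continuous_profile.
apply: ae_eq_Rintegral.
- apply: measurable_continuousM; last first.
    by apply: has_density_measurable; apply: H1loc_has_density; case: wave_is_phase.
  by have cm := H1locC_modulus_continuous wave_H1locC; continuity.
- apply: continuous_measurable_fun; apply: continuous_mul;
  last exact: continuous_profile_slope.
  exact: continuous_compose.
have := @filterI _ _ (ae_filter_ringOfSetsType mu) _ _ wave_derivative
  (phase_weak_derivative_ae Hv wave_is_phase).
apply: ae_imply => x [H1 H2].
have [vR vI] := phase_components wave_is_phase x.
(* Since Im v' = 0, the relation for phi' multiplied by rho reads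
   [rho ^ 2 * phi' = - Im v * Re v' = m * X']. *)
have H3 : (X x ^+ 2 + m ^+ 2) * weak_derivative (phase v) x = m * ((s ^+ 2 - X x ^+ 2)
  / Num.sqrt 2).
  have W1 : complex.Im (weak_derivativeC v x) = 0 by rewrite H1.
  have W2 : complex.Re (weak_derivativeC v x) = (s ^+ 2 - X x ^+ 2) / Num.sqrt 2 by
    rewrite H1.
  rewrite -wave_modulus_sq expr2 -mulrA H2 W1 W2.
  transitivity (- (modulus (v x) * sin (phase v x)) * ((s ^+ 2 - X x ^+ 2) / Num.sqrt 2)).
    by ring.
  by rewrite -vI wave_im opprK.
rewrite F'E wave_modulus_sq.
have D0 := lt0r_neq0 (sq_gt0 (X x)).
apply: (mulfI D0); rewrite mulrCA H3.
rewrite (_ : 1 - (X x ^+ 2 + m ^+ 2) = s ^+ 2 - X x ^+ 2); last by rewrite -sm; ring.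
by field; rewrite D0 gt_eqF.
Qed.

End wave.

(** * The family of tangent lines *)

Section angle.
Context {R : realType}.
Implicit Types al be p : R.

(** Momentum of the wave with [m = cos al] and [s = sin al]; the phase of this wave turns by
    [2 * al] over the line. *)
Definition angle_momentum al : R := al - sin al * cos al.

(* Value at the momentum p of the tangent line to the curve of the waves
   (momentum, energy) at the wave of speed sqrt 2 * cos al. *)
Definition angle_energy p al : R :=
  Num.sqrt 2 * (p * cos al + sin al - sin al ^+ 3 / 3 - al * cos al).

Lemma sin_gt0_itv al : 0 < al -> al <= pi / 2 -> 0 < sin al.
Proof. move=> a0 api; apply: sin_gt0_pi; rewrite a0/=; have := @pi_gt0 R; lra. Qed.

Lemma is_derive_angle_momentum al : is_derive al 1 angle_momentum (2 * sin al ^+ 2).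
Proof.
rewrite /angle_momentum; apply: trigger_derive.
by rewrite /GRing.scale /=; have := cos2Dsin2 al; move: (cos al) (sin al) => c s; nra.
Qed.

Lemma angle_momentum_lt al be : 0 <= al -> al < be -> be <= pi / 2 ->
  angle_momentum al < angle_momentum be.
Proof.
move=> a0 ab bpi.
have [x + E] := MVT ab (fun x _ => is_derive_angle_momentum x)
  (@derivable_within_continuous _ _ _ _ (fun x _ => @ex_derive _ _ _ _ _ _ _
    (is_derive_angle_momentum x))).
rewrite in_itv/= => /andP[ax xb].
rewrite -subr_gt0 E mulr_gt0 ?subr_gt0// mulr_gt0// exprn_gt0// sin_gt0_itv; lra.
Qed.

Lemma is_derive_angle_energy p al : is_derive al 1 (angle_energy p)
  (Num.sqrt 2 * sin al * (angle_momentum al - p)).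
Proof.
rewrite /angle_energy; apply: trigger_derive.
rewrite /GRing.scale /= /angle_momentum; have := cos2Dsin2 al => H.
rewrite [cos al ^+ 2 + _]addrC in H.
have -> : cos al = cos al * (sin al ^+ 2 + cos al ^+ 2) by rewrite H mulr1.
by field.
Qed.

Lemma angle_energy_critical p al : angle_momentum al = p ->
  angle_energy p al = 2 * Num.sqrt 2 / 3 * sin al ^+ 3.
Proof.
move=> <-; rewrite /angle_energy /angle_momentum.
have -> : (al - sin al * cos al) * cos al = al * cos al - sin al * (1 - sin al ^+ 2).
  by rewrite -cos2sin2; ring.
by field.
Qed.

(** For angles in []0, pi / 2[] the derivative has the sign of [angle_momentum - p]: negative before
    al, positive after. The closed range of be includes 0, the angle used for a modulus nowhere
    below 1. *)
Lemma angle_energy_min p al be : 0 < al < pi / 2 -> angle_momentum al = p ->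
  0 <= be <= pi / 2 -> be != al -> angle_energy p al < angle_energy p be.
Proof.
move=> /andP[a0 api] <- /andP[b0 bpi].
have cE q x y : {within `[x, y], continuous (angle_energy q)}.
  apply: continuous_subspaceT => z; apply/differentiable_continuous/derivable1_diffP.
  by case: (is_derive_angle_energy q z).
have s2 : 0 < Num.sqrt 2 :> R by rewrite sqrtr_gt0.
rewrite neq_lt => /orP[ba|ab].
  have [x + E] := MVT ba (fun x _ => is_derive_angle_energy (angle_momentum al) x) (cE
    _ _ _).
  rewrite in_itv/= => /andP[bx xa].
  rewrite -subr_lt0 E mulrC pmulr_rlt0 ?subr_gt0//.
  rewrite pmulr_rlt0 ?subr_lt0 ?angle_momentum_lt//; try lra.
  by rewrite mulr_gt0// sin_gt0_itv; lra.
have [x + E] := MVT ab (fun x _ => is_derive_angle_energy (angle_momentum al) x) (cE _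
  _ _).
rewrite in_itv/= => /andP[ax xb].
rewrite -subr_gt0 E mulr_gt0 ?subr_gt0// mulr_gt0 ?subr_gt0 ?angle_momentum_lt//; try lra.
by rewrite mulr_gt0// sin_gt0_itv; lra.
Qed.

Lemma angle_momentum_surjective p : 0 < p < pi / 2 ->
  exists2 al, 0 < al < pi / 2 & angle_momentum al = p.
Proof.
move=> /andP[p0 ppi].
have pi0 := @pi_gt0 R.
have [|||al] := @IVT R angle_momentum 0 (pi / 2) p.
- lra.
- apply: continuous_subspaceT => z; apply/differentiable_continuous/derivable1_diffP.
  by case: (is_derive_angle_momentum z).
- rewrite /angle_momentum sin0 mul0r subrr cos_pihalf mulr0 subr0.
  have h : 0 <= pi / 2 :> R by lra.
  by rewrite (min_l h) (max_r h) (ltW p0) (ltW ppi).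
rewrite in_itv/= => /andP[a0 api] E; exists al => //.
rewrite !lt_neqAle a0 api !andbT; apply/andP; split; apply/eqP => H; move: E.
  by rewrite -H /angle_momentum sin0 mul0r subrr; lra.
by rewrite H /angle_momentum cos_pihalf mulr0 subr0; lra.
Qed.

Lemma cos_div_sin_atan al : 0 < al < pi / 2 -> atan (cos al / sin al) = pi / 2 - al.
Proof.
move=> /andP[a0 api]; have pi0 := @pi_gt0 R.
rewrite -[RHS]tanK; last by rewrite in_itv/=; apply/andP; split; lra.
by rewrite /tan sinB cosB cos_pihalf sin_pihalf !mul0r !mul1r subr0 add0r.
Qed.

Lemma tan_sin_cos_atan al : 0 < al < pi / 2 -> atan (sin al / cos al) = al.
Proof.
move=> /andP[a0 api]; have pi0 := @pi_gt0 R.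
by rewrite -[RHS]tanK// in_itv/=; apply/andP; split; lra.
Qed.

Lemma acos_itv (x : R) : 0 < x < 1 -> [/\ 0 < acos x, acos x < pi / 2 & cos (acos x) = x].
Proof.
move=> /andP[x0 x1]; have pi0 := @pi_gt0 R.
have ca : cos (acos x) = x by rewrite acosK// in_itv/=; apply/andP; split; lra.
split => //; first by apply: acos_gt0; lra.
rewrite ltNge; apply/negP => pia.
have alpi : acos x <= pi by apply: acos_lepi; apply/andP; split; lra.
have : 0 <= sin (acos x - pi / 2) by apply: sin_ge0_pi; apply/andP; split; lra.
by rewrite sinB cos_pihalf sin_pihalf ca; lra.
Qed.

(** For [c = sqrt 2 * cos al] one has [sqrt (2 - c ^ 2) = sqrt 2 * sin al], and the equation
    defining the speed becomes [p = al - sin al * cos al]. Whatever c is picked has such an angle,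
    and surjectivity of [angle_momentum] rules out the default value. *)
Lemma speed_angle p : 0 < p < pi / 2 ->
  exists al, [/\ 0 < al < pi / 2, angle_momentum al = p & speed p = Num.sqrt 2 * cos al].
Proof.
move=> pp.
have s2 : 0 < Num.sqrt 2 :> R by rewrite sqrtr_gt0.
have q2 : Num.sqrt 2 ^+ 2 = 2 :> R by rewrite sqr_sqrtr.
have key al : 0 < al < pi / 2 ->
    pi / 2 - atan (Num.sqrt 2 * cos al / Num.sqrt (2 - (Num.sqrt 2 * cos al) ^+ 2))
     - Num.sqrt 2 * cos al / 2 * Num.sqrt (2 - (Num.sqrt 2 * cos al) ^+ 2) =
       angle_momentum al.
  move=> aa; have /andP[a0 api] := aa.
  have sa := sin_gt0_itv a0 (ltW api).
  have -> : 2 - (Num.sqrt 2 * cos al) ^+ 2 = 2 * sin al ^+ 2.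
    by rewrite exprMn q2 sin2cos2; ring.
  rewrite sqrtrM// sqrtr_sqr gtr0_norm// -mulf_div divff ?gt_eqF// mul1r
    cos_div_sin_atan//.
  rewrite /angle_momentum (_ : _ / 2 * _ = Num.sqrt 2 ^+ 2 / 2 * (sin al * cos al));
    last by ring.
  by rewrite q2; field.
have cos1 al : 0 < al < pi / 2 -> 0 < cos al < 1.
  move=> /andP[a0 api]; have sa := sin_gt0_itv a0 (ltW api).
  have ca : 0 < cos al by apply: cos_gt0_pihalf; apply/andP; split; lra.
  by rewrite ca/=; have := cos2Dsin2 al; nra.
rewrite /speed; case: xgetP => [c _ [c0 c2 cE]|noc].
  pose al : R := acos (c / Num.sqrt 2).
  have c1 : 0 < c / Num.sqrt 2 < 1.
    by apply/andP; split; [exact: divr_gt0|rewrite ltr_pdivrMr// mul1r].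
  have [a0 api cal] := acos_itv c1.
  have cc : c = Num.sqrt 2 * cos al by rewrite cal mulrC divfK// gt_eqF.
  exists al; split; rewrite ?a0 ?api//.
  by rewrite cE cc key// a0.
have [al aa aE] := angle_momentum_surjective pp.
have /andP[ca ca1] := cos1 _ aa.
exfalso; apply: (noc (Num.sqrt 2 * cos al)); split.
- exact: mulr_gt0.
- by rewrite gtr_pMr.
- by rewrite key.
Qed.

End angle.

(** * Maps of finite energy *)

Section finite_energy.
Context {R : realType}.
Notation mu := (@lebesgue_measure R).
Context (rho r f : R -> R).
Context (hrho : has_density rho r) (mf : measurable_fun setT f) (rho_ge0 : forall x,
  0 <= rho x).

Definition polar_density (x : R) : R :=
  2^-1 * (r x ^+ 2 + (rho x * f x) ^+ 2) + 4^-1 * (1 - rho x ^+ 2) ^+ 2.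
Local Notation e := polar_density.

Context (efin : (\int[mu]_(x in setT) (e x)%:E < (2 * Num.sqrt 2 / 3)%:E)%E).

Let E := \int[mu]_(x in setT) e x.
Let sqrt2_gt0 : 0 < Num.sqrt 2 :> R. Proof. by rewrite sqrtr_gt0. Qed.
Let sqrt2_sq : Num.sqrt 2 ^+ 2 = 2 :> R. Proof. by rewrite sqr_sqrtr. Qed.
Let crho : continuous rho. Proof. exact: has_density_continuous hrho. Qed.
Let mr : measurable_fun setT r. Proof. exact: has_density_measurable hrho. Qed.

Lemma polar_density_ge0 x : 0 <= e x.
Proof. by rewrite addr_ge0// mulr_ge0 ?invr_ge0// ?addr_ge0 ?sqr_ge0. Qed.

Lemma measurable_polar_density : measurable_fun setT e.
Proof.
apply: measurable_funD.
  apply: measurable_funM => //; apply: measurable_funD; apply: measurable_funX => //.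
  by apply: measurable_continuousM.
by apply: continuous_measurable_fun; continuity.
Qed.

Lemma integrable_polar_density : mu.-integrable setT (EFin \o e).
Proof.
apply/integrableP; split; first by apply/measurable_EFinP;
  exact: measurable_polar_density.
under eq_integral do rewrite /= ger0_norm ?polar_density_ge0//.
by rewrite (lt_trans efin)// ltry.
Qed.

Lemma polar_energy_lt : E < 2 * Num.sqrt 2 / 3.
Proof.
by rewrite -lte_fin /E /Rintegral fineK//;
  exact: integrable_fin_num integrable_polar_density.
Qed.

Lemma dominated_integrable_polar (h : R -> R) C : measurable_fun setT h ->
  (forall x, `|h x| <= C * e x) -> mu.-integrable setT (EFin \o h).
Proof.
move=> mh hC; have := integrable_EFinZ C measurableT integrable_polar_density.
apply: le_integrable => //; first exact/measurable_EFinP.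
by move=> x _ /=; rewrite lee_fin (le_trans (hC x))// ler_norm.
Qed.

Let M_exists : exists M, has_density M e.
Proof.
apply: density_exists => [|a b]; first exact: measurable_polar_density.
by apply: integrableS integrable_polar_density.
Qed.

Let M := projT1 (cid M_exists).
Let hM : has_density M e. Proof. exact: projT2 (cid M_exists). Qed.
Let Mnd a b : a <= b -> M a <= M b.
Proof. exact: density_ge0 polar_density_ge0 hM a b. Qed.

Let M_le x y : M y - M x <= E.
Proof.
have H := integrable_density_cvg hM integrable_polar_density.
have [n nx ny] : exists2 n : nat, - n%:R <= x & y <= n%:R.
  exists (Num.truncn (`|x| + `|y|)).+1.
    have := truncnS_gt (`|x| + `|y|); have := ler_norm (- x); have := normr_ge0 y.
    by rewrite normrN; lra.
  by have := truncnS_gt (`|x| + `|y|); have := ler_norm y; have := normr_ge0 x; lra.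
apply: (@le_trans _ _ (M n%:R - M (- n%:R))); first by have := Mnd nx; have := Mnd ny;
  lra.
have -> : E = limn (fun n : nat => M n%:R - M (- n%:R)) by apply/esym/cvg_lim.
apply: (@nondecreasing_cvgn_le _ (fun n : nat => M n%:R - M (- n%:R))).
  apply/nondecreasing_seqP => k; apply: lerB; apply: Mnd; rewrite ?lerN2 ler_nat//.
by apply/cvg_ex; exists E.
Qed.

(** [M] is monotone and bounded, so these are its limits at both ends: [Lp - M x] and [M x - Lm] are
    the energies to the right and to the left of x. *)
Let Lp := sup (range M).
Let Lm := inf (range M).
Let Mub : has_ubound (range M).
Proof. by exists (M 0 + E) => _ [x _ <-]; have := M_le 0 x; lra. Qed.
Let Mlb : has_lbound (range M).
Proof. by exists (M 0 - E) => _ [x _ <-]; have := M_le x 0; lra. Qed.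
Let M_Lp x : M x <= Lp. Proof. by apply: ub_le_sup => //; exists x. Qed.
Let Lm_M x : Lm <= M x. Proof. by apply: ge_inf => //; exists x. Qed.
Let Lp_Lm : Lp - Lm <= E.
Proof.
rewrite lerBlDr; apply: ge_sup; first by exists (M 0), 0.
move=> _ [y _ <-]; rewrite -lerBlDl; apply: lb_le_inf; first by exists (M 0), 0.
by move=> _ [x _ <-]; have := M_le x y; lra.
Qed.

Let near_one X d (s : bool) : 0 < d ->
  exists y, (if s then X <= y else y <= X) /\ `|1 - rho y ^+ 2| < d.
Proof.
move=> d0; apply: contrapT => H.
have big y : (if s then X <= y else y <= X) -> d <= `|1 - rho y ^+ 2|.
  by move=> Xy; rewrite leNgt; apply/negP => h; apply: H; exists y.
have E0 : 0 <= E by apply: Rintegral_ge0 => x _; exact: polar_density_ge0.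
(* If [|1 - rho ^ 2|] were at least d on a whole half line, an interval of this length would carry
   potential energy at least [E + 1]. *)
pose len := 4 * (E + 1) / d ^+ 2.
have len0 : 0 < len by rewrite divr_gt0 ?exprn_gt0// mulr_gt0// ltr_wpDl.
pose a := if s then X else X - len.
have key : d ^+ 2 / 4 * len <= M (a + len) - M a.
  have alen : a <= a + len by rewrite lerDl ltW.
  case: (hM) => _ iM -> //.
  have -> : d ^+ 2 / 4 * len = \int[mu]_(x in `[a, (a + len)]) (d ^+ 2 / 4).
    rewrite Rintegral_cst// [X in fine X]lebesgue_measure_itv/= lte_fin ltrDl len0/=.
    by rewrite addrAC subrr add0r.
  apply: le_Rintegral => //.
    by apply: continuous_integrable_itv; exact: continuous_constant.
  move=> x; rewrite /= in_itv/= => /andP[ax xa].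
  have dx : d <= `|1 - rho x ^+ 2|.
    by apply: big; move: ax xa; rewrite /a; case: (s); lra.
  have : d ^+ 2 <= (1 - rho x ^+ 2) ^+ 2.
    by rewrite -(real_normK (num_real (1 - rho x ^+ 2))) ler_pXn2r// nnegrE// ltW.
  by rewrite /e; have := sqr_ge0 (r x); have := sqr_ge0 (rho x * f x); lra.
have := M_le a (a + len).
have : d ^+ 2 / 4 * len = E + 1 by rewrite /len; field; rewrite gt_eqF.
by lra.
Qed.

(** Modica-Mortola function: its derivative [(1 - y ^ 2) / sqrt 2] is such that [|(G0 o rho)'|] is
    at most the energy density, by the arithmetic-geometric inequality. *)
Let G0 y : R := (y - y ^+ 3 / 3) / Num.sqrt 2.

Let G0_variation x y : x <= y -> `|G0 (rho y) - G0 (rho x)| <= M y - M x.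
Proof.
move=> xy.
have c0 : continuous ((fun y : R => (1 - y ^+ 2) / Num.sqrt 2) \o rho).
  by rewrite /comp; continuity.
have hG : has_density (G0 \o rho) (fun x => (1 - rho x ^+ 2) / Num.sqrt 2 * r x).
  apply: (@has_density_comp _ G0 (fun y => (1 - y ^+ 2) / Num.sqrt 2) rho r _ c0 hrho)
    => z.
  rewrite /G0; apply: trigger_derive; rewrite /GRing.scale /=; field.
  by rewrite gt_eqF.
case: (hG) => mG iG /(_ _ _ xy) /= ->; case: (hM) => _ iM -> //.
rewrite (le_trans (le_normr_Rintegral _ _))//; apply: le_Rintegral => //.
  exact: integrable_norm_itv.
move=> z _; rewrite /e.
have := sqr_ge0 (rho z * f z).
have h2 : (Num.sqrt 2)^-1 ^+ 2 = 2^-1 :> R by rewrite exprVn sqrt2_sq.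
have h3 := sqrt2_gt0; rewrite -invr_gt0 in h3.
move: h2 h3; set k := (Num.sqrt 2)^-1 => h2 h3.
move: (1 - rho z ^+ 2) (r z) (_ ^+ 2) => et w q q0.
have : 0 <= (k * w - et / 2) ^+ 2 by exact: sqr_ge0.
have : 0 <= (k * w + et / 2) ^+ 2 by exact: sqr_ge0.
rewrite !sqrrD sqrrN !exprMn h2 => P1 P2.
rewrite ler_norml; apply/andP; split; lra.
Qed.

(** This is [G0 1 - G0 y], the least energy needed to join modulus y to modulus 1. *)
Let kappa y : R := (2 / 3 - y + y ^+ 3 / 3) / Num.sqrt 2.

(** On each side of x there are points where the modulus is as close to 1 as desired, and reaching
    them costs at least the variation of [G0]. The value [true] of [s] stands for the right side. *)
Let kappa_tail x (s : bool) : kappa (rho x) <= if s then Lp - M x else M x - Lm.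
Proof.
apply/ler_addgt0Pr => d0 d00.
pose d := Num.min 1 d0.
have dgt0 : 0 < d by rewrite lt_min ltr01.
have d1 : d <= 1 by rewrite ge_min lexx.
have dd : d <= d0 by rewrite ge_min lexx orbT.
have [y [xy yd]] := near_one x s (divr_gt0 dgt0 (ltr0n _ 2)).
have h1 : G0 (rho y) - G0 (rho x) <= if s then Lp - M x else M x - Lm.
  case: s xy => xy.
    have := le_trans (ler_norm _) (G0_variation xy); have := M_Lp y; lra.
  have := G0_variation xy; rewrite distrC => /(le_trans (ler_norm _)).
  by have := Lm_M y; lra.
have k1 : (Num.sqrt 2)^-1 <= 1 :> R.
  rewrite invf_ple ?posrE// invr1 -[leLHS]sqrtr1 ler_sqrt//; lra.
have kp : 0 < (Num.sqrt 2)^-1 :> R by rewrite invr_gt0.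
suff h2 : kappa (rho x) <= G0 (rho y) - G0 (rho x) + d by lra.
suff : kappa (rho y) <= d by rewrite /kappa /G0; lra.
have := rho_ge0 y; move: yd; rewrite /kappa; move: (rho y) => z zd z0.
have hz : `|1 - z| < d / 2.
  apply: le_lt_trans zd; rewrite (_ : 1 - z ^+ 2 = (1 - z) * (1 + z)); last by ring.
  by rewrite normrM ler_peMr// ger0_norm; lra.
move: hz; rewrite ltr_norml => /andP[za zb].
have : (2 / 3 - z + z ^+ 3 / 3) <= d.
  rewrite (_ : _ + _ = (1 - z) ^+ 2 * (z + 2) / 3); last by field.
  have : (1 - z) ^+ 2 <= d / 2 * (d / 2) by rewrite expr2; nra.
  by have := sqr_ge0 (1 - z); nra.
have : 0 <= 2 / 3 - z + z ^+ 3 / 3.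
  rewrite (_ : _ + _ = (1 - z) ^+ 2 * (z + 2) / 3); last by field.
  by rewrite divr_ge0// mulr_ge0 ?sqr_ge0//; lra.
by move: kp k1; set k := (Num.sqrt 2)^-1; nra.
Qed.

Let kappa_E x : 2 * kappa (rho x) <= E.
Proof. by have := kappa_tail x true; have := kappa_tail x false; have := Lp_Lm; lra. Qed.

(** Both sides of x pay [kappa (rho x)], and [2 * kappa 0] is exactly [2 * sqrt 2 / 3]. Dropping the
    cubic term of [kappa] in [2 * kappa (rho x) <= E] gives the explicit bound. *)
Lemma modulus_lower_bound : exists2 d, 0 < d & forall x, d <= rho x.
Proof.
exists (2 / 3 - E / Num.sqrt 2) => [|x].
  rewrite subr_gt0 ltr_pdivrMr// mulrC mulrA; have := polar_energy_lt; lra.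
have := kappa_E x; rewrite /kappa mulrA ler_pdivrMr// => H.
rewrite lerBlDr -lerBlDl ler_pdivlMr//.
have q2 := sqrt2_sq; have q0 := sqrt2_gt0; have z0 := rho_ge0 x.
have z3 : 0 <= rho x ^+ 3 by rewrite exprn_ge0.
move: H; set q := Num.sqrt 2 in q2 q0 *;
  move: (rho x) (rho x ^+ 3) z0 z3 => z z3 z0 z30 H.
suff : (2 / 3 - z) * q * q <= E * q by rewrite ler_pM2r.
by rewrite -mulrA -expr2 q2; lra.
Qed.

Lemma modulus_cvg1 : forall d, 0 < d ->
  exists2 N, 0 < N & forall x, N <= `|x| -> `|rho x - 1| <= d.
Proof.
move=> d d0.
have q0 := sqrt2_gt0.
(* [kappa z] equals [(z - 1) ^ 2 * (z + 2) / (3 * sqrt 2)], so [kappa z <= t] yields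
   [(z - 1) ^ 2 <= d ^ 2 / sqrt 2]. *)
pose t := d ^+ 2 / 3.
have t0 : 0 < t by rewrite divr_gt0// exprn_gt0.
have hp : has_sup (range M) by split => //; exists (M 0), 0.
have hm : has_inf (range M) by split => //; exists (M 0), 0.
have [_ [y1 _ <-] H1] := sup_adherent t0 hp.
have [_ [y2 _ <-] H2] := inf_adherent t0 hm.
exists (1 + `|y1| + `|y2|) => [|x Nx].
  by rewrite -addrA ltr_pwDl// addr_ge0.
have kx : kappa (rho x) <= t.
  have [x0|x0] := leP 0 x.
    have yx : y1 <= x.
      move: Nx; rewrite (ger0_norm x0); have := ler_norm y1; have := normr_ge0 y2; lra.
    have := kappa_tail x true; have := Mnd yx; rewrite -/Lp in H1; lra.
  have xy : x <= y2.
    move: Nx; rewrite (ltr0_norm x0); have := ler_norm (- y2); rewrite normrN.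
    have := normr_ge0 y1; lra.
  have := kappa_tail x false; have := Mnd xy; rewrite -/Lm in H2; lra.
move: kx; rewrite /kappa ler_pdivrMr// => kx.
have q2 : Num.sqrt 2 <= 2 :> R.
  by have := sqrt2_sq; move: (Num.sqrt 2) q0 => q q0 qq; nra.
have z0 := rho_ge0 x.
have : (rho x - 1) ^+ 2 <= d ^+ 2.
  have : (rho x - 1) ^+ 2 * 2 / 3 <= t * Num.sqrt 2.
    apply: le_trans kx; rewrite (_ : _ + rho x ^+ 3 / 3 = (rho x - 1) ^+ 2 * (rho x +
      2) / 3); last by field.
    by rewrite ler_pM2r ?invr_gt0// ler_wpM2l ?sqr_ge0//; lra.
  rewrite /t; have : 0 < d ^+ 2 by rewrite exprn_gt0.
  by move: (d ^+ 2) ((rho x - 1) ^+ 2) => D Z D0; nra.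
by rewrite -(real_normK (num_real (rho x - 1))) ler_pXn2r// nnegrE// ltW.
Qed.

End finite_energy.

(** * Calibration *)

Section signed_density.
Context {R : realType}.
Notation mu := (@lebesgue_measure R).

Definition side (a x : R) : R := if x < a then -1 else 1.

Lemma side_sq a x : side a x ^+ 2 = 1.
Proof. by rewrite /side; case: ifP => _; rewrite ?sqrrN expr1n. Qed.

Lemma measurable_side a : measurable_fun setT (side a).
Proof.
apply: measurable_fun_ifT; try exact: measurable_cst.
by apply: measurable_fun_ltr => //; exact: measurable_cst.
Qed.

(** The sign changes at [a], exactly where [u] vanishes, so the product has no jump. *)
Lemma has_density_side (u w : R -> R) a : has_density u w -> u a = 0 ->
  has_density (fun x => side a x * u x) (fun x => side a x * w x).
Proof.
move=> [mw iw uw] ua.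
have msw : measurable_fun setT (fun x => side a x * w x).
  by apply: measurable_funM => //; exact: measurable_side.
have isw x y : mu.-integrable `[x, y] (EFin \o (fun z => side a z * w z)).
  apply: le_integrable (iw x y) => //.
    by apply/measurable_EFinP; exact: measurable_funTS.
  move=> z _ /=; rewrite lee_fin normrM (_ : `|side a z| = 1) ?mul1r//.
  by rewrite /side; case: ifP => _; rewrite ?normrN normr1.
have right x y : a <= x -> x <= y ->
    \int[mu]_(z in `[x, y]) (side a z * w z) = u y - u x.
  move=> ax xy; rewrite uw//; apply: eq_Rintegral => z;
    rewrite inE/= in_itv/= => /andP[xz _].
  by rewrite /side ltNge (le_trans ax xz) mul1r.
have left x y : x <= y -> y <= a ->
    \int[mu]_(z in `[x, y]) (side a z * w z) = - (u y - u x).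
  move=> xy ya; rewrite uw//.
  have sub : `[x, y[ `<=` (`[x, y] : set R) by apply: subset_itvl; rewrite bnd_simp.
  have io (h : R -> R) : mu.-integrable `[x, y] (EFin \o h) ->
    mu.-integrable `[x, y[ (EFin \o h).
    by apply: integrableS.
  have iwo := io _ (iw x y); have iswo := io _ (isw x y).
  rewrite -(Rintegral_itv_bndo_bndc iwo) -(Rintegral_itv_bndo_bndc iswo).
  rewrite -mulN1r -RintegralZl//.
  apply: eq_Rintegral => z; rewrite inE/= in_itv/= => /andP[_ zy].
  by rewrite /side (lt_le_trans zy ya).
split => // x y xy.
have [ax|xa] := leP a x.
  by rewrite right// /side !ltNge ax (le_trans ax xy)/= !mul1r.
have [ay|ya] := leP a y.
  rewrite (RintegralU_itv (ltW xa) ay)// (left _ _ (ltW xa) (lexx a)) (right _ _ (lexx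
    a) ay) ua /side xa ltNge ay/=; ring.
by rewrite (left _ _ xy (ltW ya)) /side xa ya; ring.
Qed.

End signed_density.

(** * The calibrating slope and its primitive *)

Section calibration.
Context {R : realType}.
Implicit Types m s y : R.

(* Only y >= m matters; dividing by max y m instead of y makes slope m continuous
   on the whole line. *)
Definition slope m y : R :=
  (1 - y ^+ 2) * Num.sqrt (y ^+ 2 - m ^+ 2) / (Num.sqrt 2 * Num.max y m).

Lemma continuous_slope m : 0 < m -> continuous (slope m).
Proof.
move=> m0; rewrite /slope.
have c1 : continuous (fun y : R => Num.sqrt (y ^+ 2 - m ^+ 2)).
  by apply: (@continuous_compose _ (fun y : R => y ^+ 2 - m ^+ 2) Num.sqrt);
    [continuity|exact: sqrt_continuous].
have c2 : continuous (fun y : R => Num.max y m).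
  move=> x; apply: (@continuous_max R _ (fun y => y) (fun=> m));
    [exact: cvg_id|exact: cst_continuous].
have c3 : continuous (fun y : R => (Num.sqrt 2 * Num.max y m)^-1).
  apply: continuous_inv; first by continuity.
  by move=> x; rewrite gt_eqF// mulr_gt0 ?sqrtr_gt0// lt_max m0 orbT.
by continuity.
Qed.

Lemma slope_sq m y : 0 < m -> m <= y ->
  slope m y ^+ 2 = (1 - y ^+ 2) ^+ 2 * (y ^+ 2 - m ^+ 2) / (2 * y ^+ 2).
Proof.
move=> m0 my; rewrite /slope max_l// expr_div_n !exprMn sqr_sqrtr.
  by rewrite sqr_sqrtr.
by rewrite subr_ge0 ler_pXn2r// nnegrE ltW// (lt_le_trans m0).
Qed.

(** The substitution t = [sqrt (y ^ 2 - m ^ 2)] turns [slope m y dy] into [(1 - t ^ 2 - m ^ 2 / (t ^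
    2 + m ^ 2)) / sqrt 2 dt], for t from 0 to s. Since t is not differentiable at y = m, derivatives
    are compared on the open interval and continuity covers the ends. *)
Lemma slope_primitive G m s : 0 < m -> 0 < s -> s ^+ 2 + m ^+ 2 = 1 ->
  has_density G (slope m) ->
  G 1 - G m = (s - s ^+ 3 / 3 - m * atan (s / m)) / Num.sqrt 2.
Proof.
move=> m0 s0 sm hG.
have m1 : m < 1 by nra.
have q0 : 0 < Num.sqrt 2 :> R by rewrite sqrtr_gt0.
pose t y : R := Num.sqrt (y ^+ 2 - m ^+ 2).
pose H y := (t y - t y ^+ 3 / 3 - m * atan (t y / m)) / Num.sqrt 2.
have ct : continuous t.
  by apply: (@continuous_compose _ (fun y : R => y ^+ 2 - m ^+ 2) Num.sqrt);
    [continuity|exact: sqrt_continuous].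
have cH : continuous H.
  have ca : continuous (fun y => atan (t y / m)).
    by apply: (@continuous_compose _ (fun y => t y / m) atan); [continuity|move=> x;
      exact: continuous_atan].
  by rewrite /H; continuity.
have dH (y : R) : y \in `]m, 1[ -> is_derive y 1 (fun y => G y - H y) 0.
  rewrite in_itv/= => /andP[my y1].
  have my2 : 0 < y ^+ 2 - m ^+ 2 by nra.
  have ty0 : 0 < t y by rewrite sqrtr_gt0.
  have tsq : t y ^+ 2 = y ^+ 2 - m ^+ 2 by rewrite sqr_sqrtr// ltW.
  have y0 : 0 < y by lra.
  have dG : is_derive y 1 G (slope m y).
    by apply: (has_density_is_derive hG); exact: continuous_slope.
  have dt : is_derive y 1 t (y / t y).
    have dp : is_derive y 1 (fun y : R => y ^+ 2 - m ^+ 2) (2 * y).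
      by apply: trigger_derive; rewrite /GRing.scale /=; ring.
    have ds := is_derive1_sqrt my2.
    have := @is_derive1_comp R Num.sqrt (fun y : R => y ^+ 2 - m ^+ 2) y _ _ ds dp.
    by move=> /is_derive_eq; apply; rewrite -/(t y); field; rewrite gt_eqF.
  have da : is_derive y 1 (fun y => atan (t y / m)) ((1 + (t y / m) ^+ 2)^-1 * (y / t y
    / m)).
    have d1 : is_derive y 1 (fun y => t y / m) (y / t y / m).
      by apply: trigger_derive; rewrite /GRing.scale /=; ring.
    exact: (@is_derive1_comp R atan (fun y => t y / m) y _ _ (is_derive1_atan _) d1).
  have dHy : is_derive y 1 H (slope m y).
    rewrite /H; apply: trigger_derive; rewrite /GRing.scale /=.
    rewrite (_ : 1 + (t y / m) ^+ 2 = y ^+ 2 / m ^+ 2); last first.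
      by rewrite expr_div_n tsq; field; rewrite gt_eqF.
    rewrite /slope -/(t y) max_l ?(ltW my)//.
    have ny := lt0r_neq0 y0; have nt := lt0r_neq0 ty0; have nm := lt0r_neq0 m0.
    have nq := lt0r_neq0 q0.
    have my2' : m ^+ 2 = y ^+ 2 - t y ^+ 2 by rewrite tsq; ring.
    transitivity ((y ^+ 2 * (1 - t y ^+ 2) - m ^+ 2) / (Num.sqrt 2 * t y * y)).
      by field; rewrite ?ny ?nt ?nm ?nq.
    by rewrite my2'; field; rewrite ?ny ?nt ?nm ?nq.
  by rewrite -(subrr (slope m y)); exact: is_deriveB.
have cG := has_density_continuous hG.
have cGH : continuous (fun y => G y - H y) by continuity.
have [z _] := MVT m1 dH (continuous_subspaceT cGH).
rewrite mul0r => /eqP; rewrite subr_eq0 => /eqP E.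
have Hm : H m = 0.
  by rewrite /H /t subrr sqrtr0 expr0n/= !mul0r atan0 mulr0 !subr0 mul0r.
have H1 : H 1 = (s - s ^+ 3 / 3 - m * atan (s / m)) / Num.sqrt 2.
  have -> : H 1 = (s - s ^+ 3 / 3 - m * atan (s / m)) / Num.sqrt 2 => //.
  rewrite /H /t expr1n (_ : 1 - m ^+ 2 = s ^+ 2) ?sqrtr_sqr ?gtr0_norm//; lra.
by rewrite -H1; lra.
Qed.

End calibration.

(** * The energy identity *)

Section energy_bound.
Context {R : realType}.
Notation mu := (@lebesgue_measure R).
Context (rho r f : R -> R).
Context (hrho : has_density rho r) (mf : measurable_fun setT f) (rho_ge0 : forall x,
  0 <= rho x).
Context (efin : (\int[mu]_(x in setT) (polar_density rho r f x)%:E < (2 * Num.sqrt 2 /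
  3)%:E)%E).
Local Notation e := (polar_density rho r f).
Local Notation E := (\int[mu]_(x in setT) e x).
Local Notation p := (2^-1 * \int[mu]_(x in setT) ((1 - rho x ^+ 2) * f x)).

Let q0 : 0 < Num.sqrt 2 :> R. Proof. by rewrite sqrtr_gt0. Qed.
Let q2 : Num.sqrt 2 ^+ 2 = 2 :> R. Proof. by rewrite sqr_sqrtr. Qed.
Let crho : continuous rho. Proof. exact: has_density_continuous hrho. Qed.
Let mr : measurable_fun setT r. Proof. exact: has_density_measurable hrho. Qed.
Let ie : mu.-integrable setT (EFin \o e). Proof. exact: integrable_polar_density. Qed.

Let measurable_momentum_density : measurable_fun setT (fun x => (1 - rho x ^+ 2) * f x).
Proof. by apply: measurable_continuousM => //; continuity. Qed.

Lemma integrable_momentum_density :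
  mu.-integrable setT (EFin \o (fun x => (1 - rho x ^+ 2) * f x)).
Proof.
have [d d0 hd] := modulus_lower_bound hrho mf rho_ge0 efin.
apply: (@dominated_integrable_polar _ rho r f hrho mf efin _ (2 / d)) => // x.
have H : `|f x| <= `|rho x * f x| / d.
  by rewrite ler_pdivlMr// normrM mulrC ler_wpM2r// (le_trans (hd x))// ler_norm.
rewrite normrM (le_trans (ler_wpM2l (normr_ge0 _) H))// mulrA (mulrAC 2) ler_wpM2r
  ?invr_ge0 ?(ltW d0)//.
rewrite /polar_density; have := sqr_ge0 (r x).
rewrite -(real_normK (num_real (rho x * f x))) -(real_normK (num_real (1 - rho x ^+ 2))).
move: `|rho x * f x| `|1 - rho x ^+ 2| => A B; have := sqr_ge0 (A - B); rewrite sqrrB.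
by have := sqr_ge0 A; have := sqr_ge0 B; lra.
Qed.

(** Here [f ^ 2 <= (rho * f) ^ 2], so completing one square at speed [sqrt 2] suffices; the bound
    obtained is [angle_energy p 0]. *)
Lemma energy_ge_modulus_ge1 : (forall x, 1 <= rho x) -> Num.sqrt 2 * p <= E.
Proof.
move=> h1.
have im := integrable_momentum_density.
have -> : Num.sqrt 2 * p = \int[mu]_(x in setT) (Num.sqrt 2 / 2 * ((1 - rho x ^+ 2) * f
  x)).
  by rewrite RintegralZl//; ring.
apply: le_Rintegral => //; first exact: integrable_EFinZ.
move=> x _; rewrite /polar_density.
have := sqr_ge0 (Num.sqrt 2 / 2 * f x - (1 - rho x ^+ 2) / 2).
rewrite sqrrB !exprMn q2 exprVn.
have := sqr_ge0 (r x); have : f x ^+ 2 <= (rho x * f x) ^+ 2.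
  by rewrite exprMn ler_peMl ?sqr_ge0// exprn_ege1.
by rewrite exprMn; move: (rho x ^+ 2 * f x ^+ 2) ((1 - rho x ^+ 2)) => A B; nra.
Qed.

Section minimum.
Context (a m s : R) (m0 : 0 < m) (s0 : 0 < s) (sm : s ^+ 2 + m ^+ 2 = 1).
Context (rho_a : rho a = m) (m_rho : forall x, m <= rho x).

Definition calibration_defect x : R :=
  2^-1 * (r x - side a x * slope m (rho x)) ^+ 2 +
  2^-1 * (rho x * f x - m * (1 - rho x ^+ 2) / (Num.sqrt 2 * rho x)) ^+ 2.
Local Notation q := calibration_defect.

Let rho_gt0 x : 0 < rho x. Proof. exact: lt_le_trans (m_rho x). Qed.

Let polar_density_split x : e x = q x +
  (m / Num.sqrt 2 * ((1 - rho x ^+ 2) * f x) + side a x * (slope m (rho x) * r x)).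
Proof.
rewrite /polar_density /q; have S := slope_sq m0 (m_rho x).
have R0 := lt0r_neq0 (rho_gt0 x); have Q0 := lt0r_neq0 q0.
set B := m * _ / _.
have ZB : rho x * f x * B = m / Num.sqrt 2 * ((1 - rho x ^+ 2) * f x).
  by rewrite /B; move: (rho x) R0 => z R0; field; rewrite R0 Q0.
(* The two calibrating fields have squares adding up to twice the potential. This explains the form
   of [slope]: it takes what the angular field [B] leaves. *)
have KB : slope m (rho x) ^+ 2 + B ^+ 2 = 2^-1 * (1 - rho x ^+ 2) ^+ 2.
  rewrite S /B expr_div_n !exprMn q2.
  by move: (rho x) R0 => z R0; field; rewrite R0.
rewrite -ZB; move: KB; clear ZB; move: (rho x * f x) ((1 - rho x ^+ 2) ^+ 2) => F H.
by rewrite !sqrrB [(side a x * _) ^+ 2]exprMn side_sq mul1r; lra.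
Qed.

Let c_slope : continuous (fun x => slope m (rho x)).
Proof. by apply: continuous_compose => //; exact: continuous_slope. Qed.

Let m_cross : measurable_fun setT (fun x => side a x * (slope m (rho x) * r x)).
Proof.
by apply: measurable_funM; [exact: measurable_side|exact: measurable_continuousM].
Qed.

Let i_cross : mu.-integrable setT (EFin \o (fun x => side a x * (slope m (rho x) * r x))).
Proof.
apply: (@dominated_integrable_polar _ rho r f hrho mf efin _ 1) => // x.
rewrite mul1r normrM (_ : `|side a x| = 1) ?mul1r; last first.
  by rewrite /side; case: ifP => _; rewrite ?normrN normr1.
have S : slope m (rho x) ^+ 2 <= 2^-1 * (1 - rho x ^+ 2) ^+ 2.
  rewrite slope_sq// ler_pdivrMr ?mulr_gt0 ?exprn_gt0//.
  have := mulr_ge0 (sqr_ge0 (1 - rho x ^+ 2)) (sqr_ge0 m).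
  by move: ((1 - rho x ^+ 2) ^+ 2) => H; lra.
rewrite /polar_density; move: S; have := sqr_ge0 (rho x * f x).
move: (slope m (rho x)) (r x) ((1 - _) ^+ 2) (_ ^+ 2) => k w B A A0 S.
have := sqr_ge0 (k - w); have := sqr_ge0 (k + w); rewrite sqrrB sqrrD => P1 P2.
by rewrite ler_norml; apply/andP; split; lra.
Qed.

Lemma measurable_calibration_defect : measurable_fun setT q.
Proof.
have cr : continuous (fun x => (Num.sqrt 2 * rho x)^-1).
  by apply: continuous_inv; [continuity|move=> x; rewrite mulf_neq0 ?gt_eqF].
apply: measurable_funD; apply: measurable_funM => //; apply: measurable_funX;
  apply: measurable_funB => //.
- apply: measurable_funM; first exact: measurable_side.
  exact: continuous_measurable_fun.
- exact: measurable_continuousM.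
- by apply: continuous_measurable_fun; continuity.
Qed.

Lemma calibration_defect_ge0 x : 0 <= q x.
Proof. by rewrite addr_ge0// mulr_ge0 ?invr_ge0 ?sqr_ge0. Qed.

Let i_rest : mu.-integrable setT (EFin \o (fun x =>
  m / Num.sqrt 2 * ((1 - rho x ^+ 2) * f x) + side a x * (slope m (rho x) * r x))).
Proof.
apply: integrable_EFinD => //.
by apply: integrable_EFinZ => //; exact: integrable_momentum_density.
Qed.

Lemma integrable_calibration_defect : mu.-integrable setT (EFin \o q).
Proof.
rewrite (_ : q = fun x => e x - (m / Num.sqrt 2 * ((1 - rho x ^+ 2) * f x) + side a x *
  (slope m (rho x) * r x))).
  exact: integrable_EFinB.
by apply/funext => x; rewrite polar_density_split addrK.
Qed.

(** The integrand is the density of [side a * (G o rho - G m)]. As rho tends to 1 at both ends, each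
    half line contributes [G 1 - G m]. *)
Let cross_integral : \int[mu]_(x in setT) (side a x * (slope m (rho x) * r x)) =
  Num.sqrt 2 * (s - s ^+ 3 / 3 - m * atan (s / m)).
Proof.
have [G hG] := continuous_density_exists (continuous_slope m0).
have cG : continuous G := has_density_continuous hG.
have hGrho : has_density (fun x => G (rho x) - G m) (fun x => slope m (rho x) * r x).
  have h1 : has_density (G \o rho) (fun x => slope m (rho x) * r x).
    apply: (@has_density_comp _ G (slope m) rho r _ _ hrho) => // x.
    by apply: (has_density_is_derive hG); exact: continuous_slope.
  have := has_densityB h1 (has_density_cst (G m)).
  by apply: eq_has_density => x //; rewrite subr0.
have Ga : G (rho a) - G m = 0 by rewrite rho_a subrr.
have hN := has_density_side hGrho Ga.
have Glim (b : bool) : G (rho (if b then n%:R else - n%:R)) @[n --> \oo] --> G 1.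
  apply: (@cvg_comp _ _ _ (fun n : nat => rho (if b then n%:R else - n%:R)) G _ _ _ _
    (cG 1)).
  apply/cvgrPdist_le => d d0.
  have [N N0 HN] := modulus_cvg1 hrho mf rho_ge0 efin d0.
  near=> n; rewrite distrC; apply: HN.
  have nN : N <= n%:R by near: n; exact: nbhs_infty_ger.
  by case: (b); rewrite ?normrN normr_nat.
have := integrable_density_cvg hN i_cross.
set I := \int[mu]_(x in _) _ => HI.
have H2 : side a n%:R * (G (rho n%:R) - G m) - side a (- n%:R) * (G (rho (- n%:R)) - G m)
    @[n --> \oo] --> (G 1 - G m) + (G 1 - G m).
  have : (G (rho n%:R) - G m) + (G (rho (- n%:R)) - G m) @[n --> \oo] --> (G 1 - G m) +
    (G 1 - G m).
    by apply: cvgD; apply: cvgB; [exact: (Glim true)|exact: cvg_cst|exact: (Glim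
      false)|exact: cvg_cst].
  apply: cvg_trans; apply: near_eq_cvg; near=> n.
  have an : `|a| < n%:R by near: n; exact: nbhs_infty_gtr.
  rewrite /side ltNge (le_trans (ler_norm a) (ltW an))/=.
  have -> : - n%:R < a by have := ler_norm (- a); rewrite normrN; lra.
  by ring.
have -> : I = (G 1 - G m) + (G 1 - G m) by exact: (cvg_unique _ HI H2).
rewrite (slope_primitive m0 s0 sm hG); set X := _ - _ - _.
transitivity (X * (2 / Num.sqrt 2)); first by ring.
rewrite (_ : 2 / Num.sqrt 2 = Num.sqrt 2); first by rewrite mulrC.
by apply: (mulIf (lt0r_neq0 q0)); rewrite divfK ?gt_eqF// -expr2.
Unshelve. all: by end_near. Qed.

(** For [m = cos be] and [s = sin be] the second term is [angle_energy p be]. *)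
Lemma energy_identity : E = \int[mu]_(x in setT) q x +
  Num.sqrt 2 * (m * p + s - s ^+ 3 / 3 - m * atan (s / m)).
Proof.
have im := integrable_momentum_density.
transitivity (\int[mu]_(x in setT) (q x +
   (m / Num.sqrt 2 * ((1 - rho x ^+ 2) * f x) + side a x * (slope m (rho x) * r x)))).
  by apply: eq_Rintegral => x _; rewrite polar_density_split.
rewrite RintegralD//; last exact: integrable_calibration_defect.
congr (_ + _).
rewrite RintegralD//; last exact: integrable_EFinZ.
rewrite RintegralZl// cross_integral.
rewrite (_ : m / Num.sqrt 2 = m * (Num.sqrt 2 / 2)); first by ring.
congr (_ * _).
by apply: (mulIf (lt0r_neq0 q0)); rewrite mulVf ?gt_eqF// mulrAC -expr2 q2 divff.
Qed.

Lemma calibrated_ae : \int[mu]_(x in setT) q x = 0 ->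
  {ae mu, forall x, r x = side a x * slope m (rho x)} /\
  {ae mu, forall x, f x = m * (1 - rho x ^+ 2) / (Num.sqrt 2 * rho x ^+ 2)}.
Proof.
move=> Q0.
have iq := integrable_calibration_defect.
have Q1 : (\int[mu]_(x in setT) `|(q x)%:E| = 0)%E.
  rewrite -[RHS]/(0%:E) -Q0 /Rintegral fineK ?integrable_fin_num//.
  by apply: eq_integral => x _; rewrite gee0_abs// lee_fin calibration_defect_ge0.
have mq : measurable_fun setT (EFin \o q).
  by apply/measurable_EFinP; exact: measurable_calibration_defect.
have /(_ Q1) ae0 := (ae_eq_integral_abs mu measurableT mq).1.
have ae1 : {ae mu, forall x, q x = 0}.
  by apply: ae_imply ae0 => x /(_ I) [].
have sq0 x : r x - side a x * slope m (rho x) = 0 /\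
    rho x * f x - m * (1 - rho x ^+ 2) / (Num.sqrt 2 * rho x) = 0 \/ q x != 0.
  have [q0'|] := eqVneq (q x) 0; [left|by right].
  move: q0'; rewrite /q; set A := r x - _; set B := _ - m * _ / _ => AB.
  have A0 := sqr_ge0 A; have B0 := sqr_ge0 B.
  by split; apply/eqP; rewrite -sqrf_eq0; apply/eqP; lra.
split; apply: ae_imply ae1 => x qx; have [[A B]|] := sq0 x; rewrite ?qx ?eqxx//.
  by apply/eqP; rewrite -subr_eq0 A.
have R0 := lt0r_neq0 (rho_gt0 x).
apply: (mulfI R0); move/eqP: B; rewrite subr_eq0 => /eqP ->.
by field; rewrite R0 gt_eqF.
Qed.

End minimum.

End energy_bound.

(** * The equality case *)

Section equality.
Context {R : realType}.
Notation mu := (@lebesgue_measure R).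

Lemma has_density_ae (u w w' : R -> R) : has_density u w -> measurable_fun setT w' ->
  {ae mu, forall x, w x = w' x} -> has_density u w'.
Proof.
move=> [mw iw uw] mw' ww'.
have E (x y : R) (h h' : R -> \bar R) : measurable_fun setT h -> measurable_fun setT h' ->
    {ae mu, forall x, h x = h' x} ->
    (\int[mu]_(z in `[x, y]) h z = \int[mu]_(z in `[x, y]) h' z)%E.
  move=> mh mh' hh'; apply: ae_eq_integral => //; try exact: measurable_funTS.
  by apply: ae_imply hh' => z ->.
have mE : measurable_fun setT (EFin \o w) by exact/measurable_EFinP.
have mE' : measurable_fun setT (EFin \o w') by exact/measurable_EFinP.
split => // [x y|x y xy].
- apply/integrableP; split; first exact: measurable_funTS.
  have /integrableP[_] := iw x y;
    rewrite (E x y (fun z => `|(EFin \o w) z|%E) (fun z => `|(EFin \o w') z|%E))//.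
  + exact: measurableT_comp.
  + exact: measurableT_comp.
  + by apply: ae_imply ww' => z /= ->.
- rewrite uw//; congr fine; apply: (E x y (EFin \o w) (EFin \o w')) => //.
  by apply: ae_imply ww' => z /= ->.
Qed.

Lemma has_density_shift (u w : R -> R) a : continuous w -> has_density u w ->
  has_density (fun x => u (x - a)) (fun x => w (x - a)).
Proof.
move=> cw uw.
have h1 : has_density (fun x : R => x - a) (fun=> 1).
  have := has_densityB (@has_density_id R) (has_density_cst a).
  by apply: eq_has_density => x //=; rewrite subr0.
have c1 : continuous (w \o (fun x : R => x - a)).
  by apply: (@continuous_compose _ (fun x : R => x - a) w) => //; continuity.
have := @has_density_comp _ u w (fun x => x - a) (fun=> 1)
  (fun x => has_density_is_derive uw (cw _)) c1 h1.
by apply: eq_has_density => x //=; rewrite mulr1.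
Qed.

(* At a point where z = m the equation z' = slope m z has non-unique solutions:
   z may stay equal to m for a while, which only delays its growth. *)
Lemma slope_comparison (z : R -> R) (m s : R) : 0 < m -> 0 < s -> s ^+ 2 + m ^+ 2 = 1 ->
  continuous z -> z 0 = m -> (forall y, m <= z y) ->
  (forall y : R, 0 < y -> is_derive y 1 z (slope m (z y))) ->
  forall y, 0 <= y -> z y ^+ 2 - m ^+ 2 <= profile s y ^+ 2.
Proof.
move=> m0 s0 sm cz z0 mz dz y1 y10.
have q0 : 0 < Num.sqrt 2 :> R by rewrite sqrtr_gt0.
(* Wherever it is positive, [W] solves the equation of the profile, W' =
   [(s ^ 2 - W ^ 2) / sqrt 2]. *)
pose W y := Num.sqrt (z y ^+ 2 - m ^+ 2).
pose T := profile s.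
have hT := has_density_profile s.
have cT : continuous T := has_density_continuous hT.
have cT' : continuous (fun x => (s ^+ 2 - profile s x ^+ 2) / Num.sqrt 2) by continuity.
have T0 : T 0 = 0 by rewrite /T /profile mulr0 /tanh oppr0 subrr mul0r mulr0.
have Tge0 y : 0 <= y -> 0 <= T y.
  by move=> y0; rewrite /T /profile mulr_ge0 ?(ltW s0)// tanh_ge0// mulr_ge0// divr_ge0
    ?ltW.
have z2 y : 0 <= z y ^+ 2 - m ^+ 2.
  by rewrite subr_ge0 ler_pXn2r// nnegrE (le_trans (ltW m0)).
have cW : continuous W.
  by apply: (@continuous_compose _ (fun y => z y ^+ 2 - m ^+ 2) Num.sqrt);
    [continuity|exact: sqrt_continuous].
have W0 : W 0 = 0 by rewrite /W z0 subrr sqrtr0.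
suff : W y1 <= T y1.
  by rewrite -(sqr_sqrtr (z2 y1)) ler_pXn2r// nnegrE ?sqrtr_ge0 ?Tge0.
rewrite leNgt; apply/negP => TW.
pose d y := W y - T y.
have cd : continuous d by rewrite /d; continuity.
pose S := [set y | 0 <= y <= y1 /\ d y <= 0].
have S0 : S 0 by split; rewrite ?lexx ?y10// /d W0 T0 subrr.
have hS : has_sup S by split; [exists 0|exists y1 => y [/andP[]]].
(* The last point up to [y1] where [W <= T]. Beyond it [W > T >= 0], so the equation for [W] holds
   and [d] is nonincreasing, whereas it would have to rise from [d t <= 0] to [d y1 > 0]. *)
set t := sup S.
have t0 : 0 <= t by apply: ub_le_sup => //; case: hS.
have ty1 : t <= y1 by apply: ge_sup; [exists 0|move=> y [/andP[]]].
have dt : d t <= 0.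
  rewrite leNgt; apply/negP => dt0.
  have /nbhs_ballP[e /= e0 he] : \forall y \near t,
    0 < d y by exact: (cd t _ (lt_nbhsr dt0)).
  have [y [/andP[y0 yy1] dy]] := sup_adherent e0 hS; rewrite -/t => tey.
  have yt : y <= t by apply: ub_le_sup; [case: hS|split => //; rewrite y0].
  have : 0 < d y by apply: he; rewrite /ball/= ger0_norm ?subr_ge0// ltrBlDr -ltrBlDl.
  by rewrite ltNge dy.
have tlt : t < y1.
  rewrite lt_neqAle ty1 andbT; apply/eqP => E; move: dt; rewrite E /d.
  by rewrite subr_le0 leNgt TW.
have after y : t < y -> y <= y1 -> 0 < d y.
  move=> ty yy1; rewrite ltNge; apply/negP => dy.
  have : y <= t by apply: ub_le_sup; [case: hS|split => //;
    rewrite yy1 (le_trans t0 (ltW ty))].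
  by rewrite leNgt ty.
have dd (y : R) : y \in `]t, y1[ -> is_derive y 1 d ((T y ^+ 2 - W y ^+ 2) / Num.sqrt 2).
  rewrite in_itv/= => /andP[ty yy1].
  have y0 : 0 < y by exact: le_lt_trans ty.
  have Wy : 0 < W y.
    by have := after _ ty (ltW yy1); rewrite /d; have := Tge0 _ (ltW y0); lra.
  have zy : 0 < z y ^+ 2 - m ^+ 2 by move: Wy; rewrite sqrtr_gt0.
  have zy0 : 0 < z y by exact: lt_le_trans (mz y).
  have W2 : W y ^+ 2 = z y ^+ 2 - m ^+ 2 by rewrite sqr_sqrtr.
  have dzy := dz y y0.
  have dp : is_derive y 1 (fun y => z y ^+ 2 - m ^+ 2) (2 * z y * slope m (z y)).
    by apply: trigger_derive; rewrite /GRing.scale /=; ring.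
  have dW : is_derive y 1 W ((s ^+ 2 - W y ^+ 2) / Num.sqrt 2).
    have := @is_derive1_comp R Num.sqrt (fun y => z y ^+ 2 - m ^+ 2) y _ _
      (is_derive1_sqrt zy) dp.
    move=> /is_derive_eq; apply.
    rewrite /slope -/(W y) max_l// (_ : s ^+ 2 - W y ^+ 2 = 1 - z y ^+ 2);
      last by rewrite W2 -sm; ring.
    by field; rewrite !gt_eqF.
  have dT : is_derive y 1 T ((s ^+ 2 - T y ^+ 2) / Num.sqrt 2).
    by apply: (has_density_is_derive hT); exact: cT'.
  rewrite (_ : (T y ^+ 2 - W y ^+ 2) / Num.sqrt 2 =
    (s ^+ 2 - W y ^+ 2) / Num.sqrt 2 - (s ^+ 2 - T y ^+ 2) / Num.sqrt 2); last by ring.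
  exact: is_deriveB.
have [y + Ed] := MVT tlt dd (continuous_subspaceT cd).
rewrite in_itv/= => /andP[ty yy1].
have y0 : 0 < y by exact: le_lt_trans ty.
have dy := after _ ty (ltW yy1); have dy1 := after _ tlt (lexx _).
have Ty := Tge0 _ (ltW y0).
have : (T y ^+ 2 - W y ^+ 2) / Num.sqrt 2 <= 0.
  rewrite pmulr_lle0 ?invr_gt0// subr_le0; move: dy; rewrite /d => dy.
  by rewrite ler_pXn2r ?nnegrE ?sqrtr_ge0//; lra.
move=> N; have : d y1 - d t <= 0 by rewrite Ed pmulr_lle0// subr_gt0.
by lra.
Qed.

Lemma modulus_le_profile (rho r : R -> R) (a m s : R) : 0 < m -> 0 < s ->
  s ^+ 2 + m ^+ 2 = 1 ->
  has_density rho r -> rho a = m -> (forall x, m <= rho x) ->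
  {ae mu, forall x, r x = side a x * slope m (rho x)} ->
  forall x, rho x ^+ 2 <= m ^+ 2 + profile s (x - a) ^+ 2.
Proof.
move=> m0 s0 sm hrho rho_a m_rho ae_r.
have crho := has_density_continuous hrho.
have csl : continuous (fun x => slope m (rho x)).
  by apply: continuous_compose => //; exact: continuous_slope.
have msl : measurable_fun setT (fun x => side a x * slope m (rho x)).
  by apply: measurable_funM; [exact: measurable_side|exact: continuous_measurable_fun].
have hr := has_density_ae hrho msl ae_r.
have cside x : x != a -> {for x, continuous (fun x => side a x * slope m (rho x))}.
  move=> xa; have cs : {for x, continuous (side a)}.
    apply: cvg_near_cst; have [xa'|ax|xa'] := ltgtP x a.
    - near=> y; rewrite /side xa' ifT//; near: y; exact: lt_nbhsl.
    - near=> y; have ay : a < y by near: y; exact: lt_nbhsr.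
      by rewrite /side !ltNge (ltW ax) (ltW ay).
    - by rewrite xa' eqxx in xa.
  by apply: continuousM => //; exact: csl.
have drho x : x != a -> is_derive x 1 rho (side a x * slope m (rho x)).
  by move=> xa; exact: (has_density_is_derive hr (cside _ xa)).
(* Both half lines at once, with d = 1 or d = -1: on the left the sign [side] and the reflection
   cancel. *)
have key (d : R) : d ^+ 2 = 1 -> (forall y, 0 < y -> side a (a + d * y) = d) ->
    forall y, 0 <= y -> rho (a + d * y) ^+ 2 - m ^+ 2 <= profile s y ^+ 2.
  move=> d2 sd; apply: (@slope_comparison (fun y => rho (a + d * y))) => //.
  - by apply: (@continuous_compose _ (fun y => a + d * y) rho) => //; continuity.
  - by rewrite mulr0 addr0.
  - move=> y y0.
    have d0 : d != 0 by apply/eqP => d0; move: d2; rewrite d0 expr0n/= => /eqP;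
      rewrite eq_sym oner_eq0.
    have ya : a + d * y != a by rewrite -subr_eq0 addrAC subrr add0r mulf_neq0// gt_eqF.
    have dl : is_derive y 1 (fun y => a + d * y) d.
      by apply: trigger_derive; rewrite /GRing.scale /=; ring.
    have := @is_derive1_comp R rho (fun y => a + d * y) y _ _ (drho _ ya) dl.
    by move=> /is_derive_eq; apply; rewrite sd// mulrC mulrA -expr2 d2 mul1r.
have s1 y : 0 < y -> side a (a + 1 * y) = 1.
  by move=> y0; rewrite /side mul1r ltNge lerDl ltW.
have s2 y : 0 < y -> side a (a + -1 * y) = -1.
  by move=> y0; rewrite /side mulN1r gtrDl oppr_lt0 y0.
have e1 : (-1 : R) ^+ 2 = 1 by rewrite sqrrN expr1n.
move=> x; rewrite -lerBlDl; have [ax|xa] := leP a x.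
  by have := key 1 (expr1n _ _) s1 (x - a); rewrite mul1r subrKC subr_ge0; apply.
have := key (-1) e1 s2 (a - x); rewrite mulN1r opprB subrKC subr_ge0.
by rewrite -[profile s (a - x)]opprK -profileN opprB sqrrN; apply; exact: ltW.
Unshelve. all: by end_near. Qed.

End equality.

(** * From equal momenta to equal profiles *)

Section rigidity.
Context {R : realType}.
Notation mu := (@lebesgue_measure R).
Context (rho r f : R -> R).
Context (hrho : has_density rho r) (mf : measurable_fun setT f) (rho_ge0 : forall x,
  0 <= rho x).
Context (efin : (\int[mu]_(x in setT) (polar_density rho r f x)%:E < (2 * Num.sqrt 2 /
  3)%:E)%E).
Context (a m s : R) (m0 : 0 < m) (s0 : 0 < s) (sm : s ^+ 2 + m ^+ 2 = 1).
Context (rho_a : rho a = m) (m_rho : forall x, m <= rho x).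
Context (ae_r : {ae mu, forall x, r x = side a x * slope m (rho x)}).
Context (ae_f : {ae mu, forall x,
  f x = m * (1 - rho x ^+ 2) / (Num.sqrt 2 * rho x ^+ 2)}).
Context (mom : 2^-1 * \int[mu]_(x in setT) ((1 - rho x ^+ 2) * f x) = atan (s / m) - s
  * m).

Let q0 : 0 < Num.sqrt 2 :> R. Proof. by rewrite sqrtr_gt0. Qed.
Let crho : continuous rho. Proof. exact: has_density_continuous hrho. Qed.
Let rho2_gt0 x : 0 < rho x ^+ 2.
Proof. by rewrite exprn_gt0// (lt_le_trans m0). Qed.

Let T x := profile s (x - a).
Let R2 x := m ^+ 2 + T x ^+ 2.

Let ct : continuous (profile s).
Proof. exact: has_density_continuous (has_density_profile s). Qed.
Let cT : continuous T.
Proof. by apply: (@continuous_compose _ (fun x => x - a) (profile s)) => //;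
  continuity. Qed.

Let R2_gt0 x : 0 < R2 x.
Proof. by rewrite ltr_pwDl ?exprn_gt0// sqr_ge0. Qed.

Let R2_lt1 x : R2 x < 1.
Proof. by rewrite /R2 -sm addrC ltrD2r; exact: profile_sq_lt. Qed.

Definition calibrated_frequency x := m * (1 - rho x ^+ 2) / (Num.sqrt 2 * rho x ^+ 2).
Local Notation f' := calibrated_frequency.

Let cf' : continuous f'.
Proof.
have ci : continuous (fun x => (Num.sqrt 2 * rho x ^+ 2)^-1).
  by apply: continuous_inv; [continuity|move=> x; rewrite mulf_neq0 ?gt_eqF].
by rewrite /calibrated_frequency; continuity.
Qed.

Let c_momentum : continuous (fun x => (1 - rho x ^+ 2) * f' x).
Proof. by continuity. Qed.

Let i_momentum : mu.-integrable setT (EFin \o (fun x => (1 - rho x ^+ 2) * f' x)).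
Proof.
apply: (@dominated_integrable_polar _ rho r f hrho mf efin _ (4 / m)).
  exact: continuous_measurable_fun.
move=> x; rewrite /calibrated_frequency.
rewrite (_ : _ * _ = (1 - rho x ^+ 2) ^+ 2 * (m / (Num.sqrt 2 * rho x ^+ 2)));
  last by ring.
have H1 : m / (Num.sqrt 2 * rho x ^+ 2) <= m^-1.
  rewrite ler_pdivrMr ?(mulr_gt0 q0 (rho2_gt0 x))// mulrC ler_pdivlMr// -expr2.
  have : m ^+ 2 <= rho x ^+ 2 by rewrite ler_pXn2r// nnegrE ltW// (lt_le_trans m0).
  have : 1 <= Num.sqrt 2 :> R by rewrite -[leLHS]sqrtr1 ler_sqrt//; lra.
  by have := rho2_gt0 x; nra.
have H0 : 0 <= m / (Num.sqrt 2 * rho x ^+ 2) by rewrite divr_ge0 ?(ltW m0)// ltW//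
  mulr_gt0.
have e0 := sqr_ge0 (1 - rho x ^+ 2).
rewrite (ger0_norm (mulr_ge0 e0 H0)); apply: (le_trans (ler_wpM2l e0 H1)).
rewrite [leRHS]mulrAC ler_wpM2r ?invr_ge0 ?(ltW m0)//.
by rewrite /polar_density; have := sqr_ge0 (r x); have := sqr_ge0 (rho x * f x); lra.
Qed.

Let momentum' : \int[mu]_(x in setT) ((1 - rho x ^+ 2) * f' x) = 2 * (atan (s / m) - s
  * m).
Proof.
rewrite -mom mulrA divff// mul1r; apply: ae_eq_Rintegral.
- exact: continuous_measurable_fun.
- by apply: measurable_continuousM => //; continuity.
- by apply: ae_imply ae_f => x ->.
Qed.

Lemma has_density_wave_phase_shift : has_density (fun x => wave_phase s m (x - a))
  (fun x => m * (s ^+ 2 - profile s (x - a) ^+ 2) / (Num.sqrt 2 * (profile s (x - a) ^+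
    2 + m ^+ 2))).
Proof.
have ci : continuous (fun x => (Num.sqrt 2 * (profile s x ^+ 2 + m ^+ 2))^-1).
  apply: continuous_inv; first by continuity.
  by move=> x; rewrite mulf_neq0 ?gt_eqF// ltr_wpDl ?sqr_ge0 ?exprn_gt0.
have cd : continuous (fun x => m * (s ^+ 2 - profile s x ^+ 2) / (Num.sqrt 2 * (profile
  s x ^+ 2 + m ^+ 2))).
  by continuity.
exact: (has_density_shift a cd (has_density_wave_phase s m0)).
Qed.

(** Primitive of the momentum density of the translated wave: along it [|v| ^ 2 * phi' = m * T'],
    hence [(1 - |v| ^ 2) * phi' = phi' - m * T']. *)
Let Q x := wave_phase s m (x - a) - m * T x.
Let hQ : has_density Q (fun x => m * (1 - R2 x) ^+ 2 / (Num.sqrt 2 * R2 x)).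
Proof.
have cd : continuous (fun x => (s ^+ 2 - profile s x ^+ 2) / Num.sqrt 2) by continuity.
have h2 := has_density_shift a cd (has_density_profile s).
have := has_densityB has_density_wave_phase_shift (has_densityZ m h2).
apply: eq_has_density => x //=; rewrite -/(T x) /R2.
have -> : s ^+ 2 - T x ^+ 2 = 1 - (m ^+ 2 + T x ^+ 2) by rewrite -sm; ring.
rewrite [T x ^+ 2 + _]addrC -/(R2 x); have R0 := lt0r_neq0 (R2_gt0 x).
by move: (R2 x) R0 => z R0; field; rewrite R0 gt_eqF.
Qed.

Let Q_lim : Q n%:R - Q (- n%:R) @[n --> \oo] --> 2 * (atan (s / m) - s * m).
Proof.
have t1 : T n%:R @[n --> \oo] --> s by exact: cvg_profile.
have t2 : T (- n%:R) @[n --> \oo] --> - s.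
  rewrite /T; under eq_cvg do rewrite -opprD profileN.
  by apply: cvgN; exact: cvg_profile.
have am : continuous (fun y : R => atan (y / m)).
  apply: (@continuous_compose _ (fun y => y / m) atan); first by continuity.
  by move=> y; exact: continuous_atan.
have a1 : atan (T n%:R / m) @[n --> \oo] --> atan (s / m) := cvg_comp _ _ t1 (am s).
have a2 : atan (T (- n%:R) / m) @[n --> \oo] --> atan (- s / m) := cvg_comp _ _ t2 (am
  (- s)).
have -> : 2 * (atan (s / m) - s * m) =
    (atan (s / m) - pi / 2 - m * s) - (atan (- s / m) - pi / 2 - m * - s).
  by rewrite mulNr atanN; ring.
rewrite /Q /wave_phase.
by apply: cvgB; apply: cvgB;
  [apply: cvgB => //; exact: cvg_cst|apply: cvgM => //; exact: cvg_cst
  |apply: cvgB => //; exact: cvg_cst|apply: cvgM => //; exact: cvg_cst].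
Qed.

Let defect x := (1 - rho x ^+ 2) * f' x - m * (1 - R2 x) ^+ 2 / (Num.sqrt 2 * R2 x).

(** Both momentum densities are [m / sqrt 2] times the function [(1 - y) ^ 2 / y], at y = [rho ^ 2]
    and at y = [R2]; the factored difference shows its sign. *)
Let defectE x : defect x =
  m / Num.sqrt 2 * ((R2 x - rho x ^+ 2) * (1 - rho x ^+ 2 * R2 x) / (rho x ^+ 2 * R2 x)).
Proof.
rewrite /defect /calibrated_frequency.
have R0 := lt0r_neq0 (R2_gt0 x); have r0 := lt0r_neq0 (rho2_gt0 x).
by move: (R2 x) (rho x ^+ 2) R0 r0 => z w R0 r0; field; rewrite R0 r0 gt_eqF.
Qed.

Let rho2_le x : rho x ^+ 2 <= R2 x.
Proof. exact: (modulus_le_profile m0 s0 sm hrho rho_a m_rho ae_r). Qed.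

Let prod_lt1 x : rho x ^+ 2 * R2 x < 1.
Proof. by have := rho2_le x; have := R2_lt1 x; have := R2_gt0 x; have := rho2_gt0 x;
  nra. Qed.

Let defect_ge0 x : 0 <= defect x.
Proof.
rewrite defectE mulr_ge0// ?divr_ge0 ?(ltW m0) ?(ltW q0)// ?mulr_ge0 ?(ltW (rho2_gt0
  _)) ?(ltW (R2_gt0 _))//.
  by rewrite subr_ge0.
by rewrite subr_ge0 ltW.
Qed.

(** [defect] is continuous and nonnegative, and its integral vanishes because the momenta agree. In
    its factored form only [R2 - rho ^ 2] can be zero, since [rho ^ 2 * R2 < 1]. *)
Lemma modulus_eq_profile x : rho x ^+ 2 = m ^+ 2 + profile s (x - a) ^+ 2.
Proof.
have [P hP] := continuous_density_exists c_momentum.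
have hD := has_densityB hP hQ.
rewrite -/(defect) in hD.
set D := (fun x => P x - Q x) in hD.
have Dnd := density_ge0 defect_ge0 hD.
have Dlim : D n%:R - D (- n%:R) @[n --> \oo] --> (0 : R).
  have c1 := integrable_density_cvg hP i_momentum.
  rewrite momentum' in c1.
  have -> : (fun n : nat => D n%:R - D (- n%:R)) =
      (fun n : nat => (P n%:R - P (- n%:R)) - (Q n%:R - Q (- n%:R))).
    by apply/funext => n; rewrite /D; ring.
  by rewrite -(subrr (2 * (atan (s / m) - s * m))); exact: (cvgB c1 Q_lim).
(* The increments of the nondecreasing [D] over [[-n, n]] grow with n and tend to 0. *)
have Dle n : D n%:R - D (- n%:R) <= 0.
  have -> : 0 = limn (fun n : nat => D n%:R - D (- n%:R)) by apply/esym/cvg_lim.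
  apply: (@nondecreasing_cvgn_le _ (fun n : nat => D n%:R - D (- n%:R))).
    by apply/nondecreasing_seqP => k; apply: lerB; apply: Dnd; rewrite ?lerN2 ler_nat.
  by apply/cvg_ex; exists 0.
have cdef : continuous defect.
  have ci : continuous (fun x => (Num.sqrt 2 * R2 x)^-1).
    apply: continuous_inv; first by rewrite /R2; continuity.
    by move=> y; rewrite mulf_neq0 ?gt_eqF.
  have cR : continuous R2 by rewrite /R2; continuity.
  by rewrite /defect; continuity.
have : defect x = 0.
  pose n := (Num.truncn `|x|).+1.
  have xn : - n%:R < x < n%:R by rewrite -ltr_norml truncnS_gt.
  apply: (continuous_Rintegral_eq0 cdef defect_ge0 _ xn).
  case: hD => _ _ <-; last exact: opp_natr_le.
  by apply/eqP; rewrite eq_le Dle/= subr_ge0; apply: Dnd; exact: opp_natr_le.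
rewrite defectE -/(T x) -/(R2 x).
move: (rho x ^+ 2) (R2 x) (rho2_gt0 x) (R2_gt0 x) (prod_lt1 x) => z w z0 w0 zw /eqP.
rewrite !mulf_eq0 !invr_eq0 !mulf_eq0 (gt_eqF m0) (gt_eqF q0) (gt_eqF z0) (gt_eqF w0)
  /= !orbF.
rewrite subr_eq0 => /orP[/eqP <- //|].
by rewrite subr_eq0 eq_sym (lt_eqF zw).
Qed.

End rigidity.

(** * Minimality and uniqueness *)

Section minimization.
Context {R : realType}.
Notation mu := (@lebesgue_measure R).

Lemma expiD (x y : R) : expi (x + y) = expi x * expi y.
Proof.
rewrite [LHS]complexE [RHS]complexE /= cosD sinD.
by congr (_%:C + _ * _%:C); ring.
Qed.

Lemma angle_trigo (al : R) : 0 < al < pi / 2 ->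
  [/\ 0 < cos al, 0 < sin al, sin al < 1 & sin al ^+ 2 + cos al ^+ 2 = 1].
Proof.
move=> /andP[a0 api]; have pi0 := @pi_gt0 R.
have c0 : 0 < cos al by apply: cos_gt0_pihalf; apply/andP; split; lra.
have s0 : 0 < sin al by apply: sin_gt0_pihalf; rewrite a0.
have sc : sin al ^+ 2 + cos al ^+ 2 = 1 by rewrite addrC cos2Dsin2.
by split => //; nra.
Qed.

Lemma wave_admissible (p al : R) : 0 < al < pi / 2 -> angle_momentum al = p ->
  admissible p (travelling_wave (Num.sqrt 2 * cos al)) /\
  energy (travelling_wave (Num.sqrt 2 * cos al)) = (angle_energy p al)%:E.
Proof.
move=> aa alp; have [m0 s0 s1 sm] := angle_trigo aa.
have E := wave_energy s0 sm.
have q0 : 0 < Num.sqrt 2 :> R by rewrite sqrtr_gt0.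
split; last by rewrite E (angle_energy_critical alp).
split; first exact: (wave_H1locC s0).
- by rewrite E lte_fin gtr_pMr ?exprn_ilt1 ?(ltW s0)// divr_gt0 ?mulr_gt0.
- by rewrite (wave_momentum s0 m0 sm) tan_sin_cos_atan// -alp.
Qed.

(** The modulus determines phi' almost everywhere, so [phi] and the phase of the translated wave
    differ by the constant theta. *)
Lemma polar_form_wave (v : R -> R[i]) (rho r phi f : R -> R) (a m s : R) :
  0 < m -> 0 < s -> s ^+ 2 + m ^+ 2 = 1 ->
  has_density rho r -> has_density phi f -> (forall x, 0 <= rho x) ->
  (forall x, v x = (rho x)%:C * expi (phi x)) ->
  (forall x, rho x ^+ 2 = m ^+ 2 + profile s (x - a) ^+ 2) ->
  {ae mu, forall x, f x = m * (1 - rho x ^+ 2) / (Num.sqrt 2 * rho x ^+ 2)} ->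
  exists theta, v = (fun x => expi theta * travelling_wave (Num.sqrt 2 * m) (x - a)).
Proof.
move=> m0 s0 sm hrho hphi rho0 vE rhoE ae_f.
have hw := has_density_wave_phase_shift a s m0.
have gE x : m * (s ^+ 2 - profile s (x - a) ^+ 2) / (Num.sqrt 2 * (profile s (x - a) ^+
  2 + m ^+ 2)) =
    m * (1 - rho x ^+ 2) / (Num.sqrt 2 * rho x ^+ 2).
  have -> : 1 - rho x ^+ 2 = s ^+ 2 - profile s (x - a) ^+ 2 by rewrite rhoE -sm; ring.
  by rewrite rhoE [m ^+ 2 + _]addrC.
have hw' := eq_has_density (fun x => erefl _) gE hw.
have hphi' := has_density_ae hphi (has_density_measurable hw') ae_f.
pose theta := phi 0 - wave_phase s m (0 - a).
exists theta; apply/funext => x.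
have -> : v x = (rho x)%:C * expi (theta + wave_phase s m (x - a)).
  rewrite vE; congr (_ * expi _).
  by have := density_primitive_cst hphi' hw' 0 x; rewrite /theta; lra.
rewrite (wave_polar s0 m0 sm) expiD mulrCA; congr (_ * (_%:C * _)).
apply/eqP; rewrite -(@eqrXn2 _ 2) ?modulus_ge0//.
by rewrite (wave_modulus_sq s0 sm) rhoE addrC.
Qed.

Lemma polar_energy_min (p al : R) (v : R -> R[i]) : 0 < p -> 0 < al < pi / 2 ->
  angle_momentum al = p -> admissible p v ->
  ((angle_energy p al)%:E <= energy v)%E /\
  (energy v = (angle_energy p al)%:E -> exists a theta : R,
     v = (fun x => expi theta * travelling_wave (Num.sqrt 2 * cos al) (x - a))).
Proof.
move=> p0 aa alp [Hv Ev pv].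
have pi0 := @pi_gt0 R.
have phv : is_phase v (phase v) by apply: momentum_phase => //; rewrite pv gt_eqF.
have [rho [r [phi [f [hrho hphi rho0 vE [EE pE]]]]]] := polar_form_exists Hv phv.
have mf := has_density_measurable hphi.
have efin : (\int[mu]_(x in setT) (polar_density rho r f x)%:E < (2 * Num.sqrt 2 /
  3)%:E)%E.
  by rewrite -EE.
have Efin : energy v = (\int[mu]_(x in setT) polar_density rho r f x)%:E.
  rewrite EE /Rintegral fineK//; apply: integrable_fin_num => //.
  exact: integrable_polar_density.
rewrite Efin lee_fin.
(* A value below 1 is what guarantees a minimum point, the modulus having limit 1 at both ends. *)
have [h1|/existsNP[x0 /negP]] := pselect (forall x, 1 <= rho x).
  have := energy_ge_modulus_ge1 hrho mf rho0 efin h1.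
  rewrite -pE pv => h2.
  have := @angle_energy_min R p al 0 aa alp.
  rewrite lexx divr_ge0 ?(ltW pi0)// => /(_ isT).
  rewrite lt_eqF; last by case/andP: aa.
  (* At angle 0 the tangent value is [sqrt 2 * p], strictly above the minimum, so no minimizer has
     modulus at least 1 everywhere. *)
  move=> /(_ isT); rewrite {2}/angle_energy sin0 cos0 mul0r expr0n/= mul0r mulr1 addr0
    !subr0 => h3.
  have h4 := lt_le_trans h3 h2.
  by split; [exact: ltW|move=> [h5]; move: h4; rewrite h5 ltxx].
rewrite -ltNge => x0lt.
have [a am] : exists a, forall x, rho a <= rho x.
  (* With half the gap as tolerance, the modulus exceeds [rho x0] outside [[-N, N]], so the minimum
     over this interval is global. *)
  have h0 : 0 < (1 - rho x0) / 2 by rewrite divr_gt0// subr_gt0.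
  have [N N0 HN] := modulus_cvg1 hrho mf rho0 efin h0.
  have far x : N <= `|x| -> rho x0 < rho x.
    by move=> /HN; rewrite ler_norml => /andP[]; lra.
  have x0N : `|x0| < N by rewrite ltNge; apply/negP => /far; rewrite ltxx.
  have [|a aN amin] := @EVT_min R rho (- N) N _ (continuous_subspaceT
    (has_density_continuous hrho)).
    by lra.
  have ax0 : rho a <= rho x0 by apply: amin; rewrite in_itv/= -ler_norml ltW.
  exists a => x; have [xN|Nx] := leP `|x| N.
    by apply: amin; rewrite in_itv/= -ler_norml.
  by rewrite (le_trans ax0)// ltW// far// ltW.
pose m := rho a.
have [d d0 hd] := modulus_lower_bound hrho mf rho0 efin.
have m0 : 0 < m := lt_le_trans d0 (hd a).
have m1 : m < 1 := le_lt_trans (am x0) x0lt.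
pose be : R := acos m.
have [be0 bepi cbe] : [/\ 0 < be, be < pi / 2 & cos be = m] by apply: acos_itv;
  rewrite m0.
have bb : 0 < be < pi / 2 by rewrite be0.
have [_ s0 _ sm] := angle_trigo bb; rewrite cbe in sm.
have ident := energy_identity hrho mf rho0 efin m0 s0 sm erefl am.
rewrite -pE pv -cbe tan_sin_cos_atan// in ident.
have Q0 : 0 <= \int[mu]_(x in setT) calibration_defect rho r f a (cos be) x.
  by apply: Rintegral_ge0 => x _; exact: calibration_defect_ge0.
have ident2 : \int[mu]_(x in setT) polar_density rho r f x =
    \int[mu]_(x in setT) calibration_defect rho r f a (cos be) x + angle_energy p be.
  by rewrite ident /angle_energy; congr (_ + _ * _); ring.
(* If the minimum of the modulus is not that of the expected wave, the tangent value alone is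
   already strictly too large. *)
have [bal|bal] := eqVneq be al; last first.
  have := @angle_energy_min R p al be aa alp _ bal.
  rewrite (ltW be0) (ltW bepi) => /(_ isT) h3.
  have h4 : angle_energy p al < \int[mu]_(x in setT) polar_density rho r f x.
    by rewrite ident2 (lt_le_trans h3)// lerDr.
  by split; [exact: ltW|move=> [h5]; move: h4; rewrite h5 ltxx].
split; first by rewrite -bal ident2 lerDr.
move=> [h4].
have Qz : \int[mu]_(x in setT) calibration_defect rho r f a m x = 0.
  by apply: (addIr (angle_energy p be)); rewrite add0r -cbe -ident2 h4 bal.
have [ae_r ae_f] := calibrated_ae hrho mf rho0 efin m0 am Qz.
have mom : 2^-1 * \int[mu]_(x in setT) ((1 - rho x ^+ 2) * f x) = atan (sin be / m) -
  sin be * m.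
  by rewrite -pE pv -cbe tan_sin_cos_atan// bal -alp.
have rhoE := modulus_eq_profile hrho mf rho0 efin m0 s0 sm erefl am ae_r ae_f mom.
exists a; rewrite -bal cbe.
exact: (polar_form_wave m0 s0 sm hrho hphi rho0 vE rhoE ae_f).
Qed.

End minimization.

Unset Implicit Arguments.

Theorem theorem2 (R : realType) (p : R) (p_gt0 : 0 < p) (p_lt : p < pi / 2) :
  [/\ admissible p !=set0,
      energy (travelling_wave (speed p)) = E_min p,
      admissible p (travelling_wave (speed p)) &
      forall v : R -> R[i], admissible p v -> energy v = E_min p ->
        exists a theta : R,
          v = (fun x => expi theta * travelling_wave (speed p) (x - a))].
Proof.
have pp : 0 < p < pi / 2 by rewrite p_gt0.
have [al [aa alp ->]] := speed_angle pp.
have [adm E] := wave_admissible aa alp.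
have Emin : energy (travelling_wave (Num.sqrt 2 * cos al)) = E_min p.
  apply/eqP; rewrite eq_le; apply/andP; split.
    apply: le_ereal_inf_tmp => _ [v Hv <-]; rewrite E.
    by have [H _] := polar_energy_min p_gt0 aa alp Hv.
  by apply: ereal_inf_lbound; exists (travelling_wave (Num.sqrt 2 * cos al)).
split => //; first by exists (travelling_wave (Num.sqrt 2 * cos al)).
move=> v Hv; rewrite -Emin E.
by have [_ H] := polar_energy_min p_gt0 aa alp Hv.
Qed.
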